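(* Let $1 \leq p < \infty$ and let $T: C^p(X,E) \to C^p(Y,F)$ be a weakly compact, separating, nowhere trivial linear operator. Then there is a partition of $Y$ into clopen subsets $(Y_\alpha)$ so that the support map of $T$ is constant on each $Y_\alpha$.
   Context: $G,H,E,F$ are real Banach spaces; $X\subseteq G$ and $Y\subseteq H$ are open. $\mathcal{S}^k(G,E)$ is the Banach space of bounded symmetric $k$-linear maps $G^k\to E$, with $\mathcal{S}^0(G,E)=E$. $C^p(X,E)$ is the space of all $f:X\to E$ such that for all integers $0\le k\le p$ the Fréchet derivative $D^kf$ ($D^0f=f$) is a continuous function from $X$ to $\mathcal{S}^k(G,E)$; $C^p(X)=C^p(X,\mathbb{R})$. $C^p(X,E)$ carries the topology generated by the seminorms $\rho_{K,k}(f)=\sup_{x\in K}\sup_{0\le j\le k}\|D^jf(x)\|$, $K\subseteq X$ compact, $0\le k\le p$; similarly for $C^p(Y,F)$. Standing assumption: there is a bump function $\varphi\in C^p(G,\mathbb{R})$ with $\varphi(x)=1$ if $\|x\|\le 1/2$, $\varphi(x)=0$ if $\|x\|\ge1$, and $\sup_{x\in G}\|D^k\varphi(x)\|<\infty$ for all $0\le k\le p$. A linear map between topological vector spaces is weakly compact if it maps some (nonempty) open set onto a relatively weakly compact set. Two functions are disjoint if at every point at least one of them is $0$. A map $T$ is separating if it maps disjoint functions to disjoint functions. $T$ is nowhere trivial if for every $y\in Y$ there is $f\in C^p(X,E)$ with $Tf(y)\ne0$. Support map: let $\mathbb{R}_\infty$ be the one-point compactification of $\mathbb{R}$, $i:X\to\mathbb{R}_\infty^{C^p(X)}$,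 $i(x)(\psi)=\psi(x)$ (a homeomorphic embedding), and let $\mathcal{A}X$ be the closure of $i(X)$. For $f\in C^p(X,E)$ let $\overline{C}(f)$ be the closure in $\mathcal{A}X$ of $i(\{x:f(x)\ne0\})$. For $y\in Y$ let $\mathcal{O}_y$ be the family of open subsets $U$ of $\mathcal{A}X$ for which there is $f\in C^p(X,E)$ with $Tf(y)\ne0$ and $\overline{C}(f)\subseteq U$. Then $h(y)$ is the unique point of $\bigcap\{\overline{U}^{\mathcal{A}X}:U\in\mathcal{O}_y\}$; for $T$ continuous, separating and nowhere trivial, $h(y)\in i(X)$, and $i(X)$ is identified with $X$, so that the support map is a (continuous) map $h:Y\to X$. *)

(* Defs.v *)
From HB Require Import structures.
From mathcomp Require Import all_boot all_order all_algebra all_fingroup.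
From mathcomp Require Import all_classical all_reals all_analysis.

Set Implicit Arguments.
Unset Strict Implicit.
Unset Printing Implicit Defensive.

Import Order.TTheory GRing.Theory Num.Theory.
Import numFieldNormedType.Exports.

Local Open Scope classical_set_scope.
Local Open Scope ring_scope.

Section SymmetricMultilinear.
Context {R : realType}.
Variables (k : nat) (G E : normedModType R).
Implicit Types (v : 'I_k -> G) (A : ('I_k -> G) -> E).

Definition multilinear_map A :=
  forall v (i : 'I_k) (a : R) (x y : G),
    A (dfwith v i (a *: x + y)) = a *: A (dfwith v i x) + A (dfwith v i y).

Definition symmetric_map A := forall v (s : {perm 'I_k}), A (v \o s) = A v.

Definition bounded_multilinear_map A :=
  exists M : R, forall v, `|A v| <= M * \prod_i `|v i|.

Definition sym_mlin_pred : pred (('I_k -> G) -> E) := fun A =>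
  `[< [/\ multilinear_map A, symmetric_map A & bounded_multilinear_map A] >].

(* The space S^k(G, E); for k = 0 it consists of the constant functions on the
   one-point type 'I_0 -> G, i.e. it is a copy of E. *)
Record sym_mlin := SymMlin {
  sym_mlin_fun :> ('I_k -> G) -> E ;
  sym_mlinP : sym_mlin_fun \in sym_mlin_pred }.

HB.instance Definition _ := [isSub for sym_mlin_fun].
HB.instance Definition _ := [Choice of sym_mlin by <:].

Lemma sym_mlin_submod_closed : submod_closed sym_mlin_pred.
Proof.
split.
  apply/asboolP; split.
  - by move=> v i a x y; rewrite /= scaler0 addr0.
  - by [].
  - by exists 0 => v; rewrite /= normr0 mul0r.
move=> a A B /asboolP[Al As [M AM]] /asboolP[Bl Bs [N BN]]; apply/asboolP; split.
- move=> v i b x y; rewrite !fctE Al Bl !scalerDr !scalerA (mulrC a b).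
  by rewrite addrACA.
- by move=> v s; rewrite !fctE As Bs.
- exists (`|a| * M + N) => v; rewrite !fctE mulrDl (le_trans (ler_normD _ _))//.
  by rewrite lerD// normrZ -mulrA ler_wpM2l.
Qed.

HB.instance Definition _ :=
  GRing.isSubmodClosed.Build R (('I_k -> G) -> E) sym_mlin_pred
    sym_mlin_submod_closed.
HB.instance Definition _ := [SubChoice_isSubLmodule of sym_mlin by <:].

Definition op_norm (A : sym_mlin) : R :=
  sup [set `|A v| | v in [set v : 'I_k -> G | forall i, `|v i| <= 1]].

Lemma op_norm_has_sup (A : sym_mlin) :
  has_sup [set `|A v| | v in [set v : 'I_k -> G | forall i, `|v i| <= 1]].
Proof.
split; first by exists `|A (fun=> 0)|, (fun=> 0) => // i; rewrite normr0.
have /asboolP[_ _ [M AM]] := sym_mlinP A.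
exists `|M| => _ [v v1 <-]; apply: le_trans (AM v) _.
apply: le_trans (ler_norm _) _; rewrite normrM ler_piMr//.
by rewrite normr_prod prodr_ile1// => i _; rewrite !normr_id normr_ge0 v1.
Qed.

Lemma op_norm_ub (A : sym_mlin) v : (forall i, `|v i| <= 1) ->
  `|A v| <= op_norm A.
Proof.
by move=> v1; apply: (sup_upper_bound (op_norm_has_sup A)); exists v.
Qed.

Lemma op_norm_le (A : sym_mlin) (M : R) :
  (forall v, (forall i, `|v i| <= 1) -> `|A v| <= M) -> op_norm A <= M.
Proof.
move=> AM; apply: ge_sup; first by case: (op_norm_has_sup A).
by move=> _ [v v1 <-]; exact: AM.
Qed.

Lemma op_normD (A B : sym_mlin) : op_norm (A + B) <= op_norm A + op_norm B.
Proof.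
apply: op_norm_le => v v1; apply: le_trans (ler_normD _ _) _.
by rewrite lerD// op_norm_ub.
Qed.

Lemma op_normZ_le a (A : sym_mlin) : op_norm (a *: A) <= `|a| * op_norm A.
Proof. by apply: op_norm_le => v v1; rewrite normrZ ler_wpM2l// op_norm_ub. Qed.

Lemma op_normZ a (A : sym_mlin) : op_norm (a *: A) = `|a| * op_norm A.
Proof.
have [->|a0] := eqVneq a 0.
  apply/eqP; rewrite normr0 mul0r scale0r eq_le; apply/andP; split.
    by apply: op_norm_le => v _; rewrite normr0.
  apply: le_trans (op_norm_ub (0 : sym_mlin) (v := fun=> 0) _) => // i.
  by rewrite normr0.
apply/eqP; rewrite eq_le op_normZ_le /= -ler_pdivlMl ?normr_gt0// -normfV.
by rewrite -[A in op_norm A <= _](scalerK a0) op_normZ_le.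
Qed.

Lemma op_norm0_eq0 (A : sym_mlin) : op_norm A = 0 -> A = 0.
Proof.
move=> A0; have {}A0 v : (forall i, `|v i| <= 1) -> A v = 0.
  by move=> /(op_norm_ub A); rewrite A0 normr_le0 => /eqP.
have /asboolP[Al _ _] := sym_mlinP A.
have AZ v i a x : A (dfwith v i (a *: x)) = a *: A (dfwith v i x).
  have A00 : A (dfwith v i 0) = 0.
    by have := Al v i (-1) 0 0; rewrite scaleN1r oppr0 addr0 scaleN1r addNr.
  by have := Al v i a x 0; rewrite addr0 A00 addr0.
apply: val_inj; apply/funext => v /=.
pose c : R := 1 + \sum_i `|v i|.
have c0 : 0 < c by rewrite ltr_pwDl// sumr_ge0.
pose u i := c^-1 *: v i.
have u1 i : `|u i| <= 1.
  rewrite normrZ gtr0_norm ?invr_gt0// ler_pdivrMl// mulr1.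
  rewrite /c (bigD1 i)//= addrCA lerDl addr_ge0// sumr_ge0//.
suff Hn : forall n, A (fun i : 'I_k => if (i < n)%N then v i else u i) = 0.
  rewrite -[RHS](Hn k); congr (A _); apply/funext => i.
  by rewrite ltn_ord.
elim=> [|n IHn]; first exact: A0.
have [kn|nk] := leqP k n.
  rewrite -[RHS]IHn; congr (A _); apply/funext => i.
  have ik := leq_trans (ltn_ord i) kn.
  by rewrite ik ltnS (ltnW ik).
set w := (fun i : 'I_k => if (i < n)%N then v i else u i) in IHn.
pose j := Ordinal nk.
have -> : (fun i : 'I_k => if (i < n.+1)%N then v i else u i)
    = dfwith w j (c *: u j).
  apply/funext => i; case: dfwithP => [|i' ji'].
    by rewrite ltnSn /u scalerA divff ?gt_eqF// scale1r.
  rewrite /w ltnS leq_eqVlt; case: eqVneq => //= i'n.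
  by case/eqP: ji'; apply/val_inj.
rewrite AZ [dfwith w j (u j)](_ : _ = w) ?IHn ?scaler0//.
apply/funext => i; case: dfwithP => // .
by rewrite /w ltnn.
Qed.

HB.instance Definition _ := @Lmodule_isNormed.Build R sym_mlin
  op_norm op_normD op_normZ op_norm0_eq0.

End SymmetricMultilinear.

Section FrechetDerivatives.
Context {R : realType}.
Variables (G E : normedModType R).

Lemma sym_mlin0_subproof (e : E) : (fun _ : 'I_0 -> G => e) \in @sym_mlin_pred R 0 G E.
Proof.
apply/asboolP; split=> //; first by move=> v [].
by exists `|e| => v; rewrite big_ord0 mulr1.
Qed.

Definition sym_mlin0 (e : E) : sym_mlin 0 G E := SymMlin (sym_mlin0_subproof e).

Definition vcons k (v : G) (w : 'I_k -> G) : 'I_k.+1 -> G :=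
  fun i => if unlift ord0 i is Some j then w j else v.

(* The differential at a point of X is that of the extension by 0 to G, which
   does not matter since X will be open. The value of [fderiv f x] is junk if
   [fderivable f x] does not hold. *)
Definition fderiv (X : set G) k (f : X -> sym_mlin k G E) (x : X) :
    sym_mlin k.+1 G E :=
  get [set A : sym_mlin k.+1 G E |
    forall v w, A (vcons v w) = 'd ('valL_0 f) (\val x) v w].

Definition fderivable (X : set G) k (f : X -> sym_mlin k G E) (x : X) : Prop :=
  differentiable ('valL_0 f) (\val x) /\
  forall v w, fderiv f x (vcons v w) = 'd ('valL_0 f) (\val x) v w.

Fixpoint frechetD (X : set G) (f : X -> E) (k : nat) : X -> sym_mlin k G E :=
  match k return X -> sym_mlin k G E with
  | 0 => fun x => sym_mlin0 (f x)
  | k'.+1 => fderiv (frechetD f k')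
  end.

Definition is_Cp (p : nat) (X : set G) (f : X -> E) : Prop :=
  (forall k, (k < p)%N -> forall x : X, fderivable (frechetD f k) x) /\
  (forall k, (k <= p)%N -> continuous (frechetD f k)).

End FrechetDerivatives.

Section CpSpace.
Context {R : realType}.
Variables (G E : normedModType R).

Lemma vcons_eta k (v : 'I_k.+1 -> G) : vcons (v ord0) (v \o lift ord0) = v.
Proof.
by apply/funext => i; rewrite /vcons; case: unliftP => [j|] ->.
Qed.

Lemma sym_mlin_vcons_inj k (A B : sym_mlin k.+1 G E) :
  (forall v w, A (vcons v w) = B (vcons v w)) -> A = B.
Proof.
by move=> AB; apply: val_inj; apply/funext => v /=; rewrite -(vcons_eta v) AB.
Qed.

Lemma sym_mlin_lin_vcons k (a : R) (A1 B1 : sym_mlin k.+1 G E)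
    (A2 B2 : sym_mlin k G E) v w :
  A1 (vcons v w) = A2 w -> B1 (vcons v w) = B2 w ->
  (a *: A1 + B1) (vcons v w) = (a *: A2 + B2) w.
Proof. exact: (congr2 (fun s t => a *: s + t)). Qed.

Lemma valL_lin (X : set G) (W : lmodType R) (a : R) (f g : X -> W) :
  'valL_0 (a *: f + g) = a *: 'valL_0 f + 'valL_0 g.
Proof.
apply/funext => x; rewrite !fctE /=; case: ('oinv_ _ x) => //=.
by rewrite scaler0 addr0.
Qed.

Lemma differentiable_valL_lin (X : set G) (W : normedModType R) (a : R)
    (f g : X -> W) (x : G) :
  differentiable ('valL_0 f) x -> differentiable ('valL_0 g) x ->
  differentiable ('valL_0 (a *: f + g)) x /\
  forall v, 'd ('valL_0 (a *: f + g)) x v =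
            a *: 'd ('valL_0 f) x v + 'd ('valL_0 g) x v.
Proof.
move=> df dg; have daf : differentiable (a *: 'valL_0 f) x.
  exact: differentiableZ.
rewrite valL_lin; split; first exact: differentiableD.
by move=> v; rewrite (diffD daf dg) (diffZ a df).
Qed.

Lemma fderivE (X : set G) k (f : X -> sym_mlin k G E) (x : X)
    (A : sym_mlin k.+1 G E) :
  (forall v w, A (vcons v w) = 'd ('valL_0 f) (\val x) v w) ->
  fderiv f x = A.
Proof.
move=> AE; apply: sym_mlin_vcons_inj => v w; rewrite AE.
exact: (getPex (ex_intro [set A : sym_mlin k.+1 G E |
  forall v w, A (vcons v w) = 'd ('valL_0 f) (\val x) v w] _ AE)).
Qed.

Lemma fderivable_lin (X : set G) k (a : R) (f g : X -> sym_mlin k G E) (x : X) :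
  fderivable f x -> fderivable g x ->
  fderivable (a *: f + g) x /\
  fderiv (a *: f + g) x = a *: fderiv f x + fderiv g x.
Proof.
move=> [fd fE] [gd gE].
have [fgd fgE] := differentiable_valL_lin a fd gd.
have E1 : fderiv (a *: f + g) x = a *: fderiv f x + fderiv g x.
  apply: fderivE => v w; rewrite fgE.
  exact: (sym_mlin_lin_vcons a (fE v w) (gE v w)).
split; last exact: E1.
split; first exact: fgd.
move=> v w; rewrite E1 fgE.
exact: (sym_mlin_lin_vcons a (fE v w) (gE v w)).
Qed.

Lemma fderiv0 (X : set G) k (x : X) :
  fderivable (0 : X -> sym_mlin k G E) x /\
  fderiv (0 : X -> sym_mlin k G E) x = 0.
Proof.
have v0 : 'valL_0 (0 : X -> sym_mlin k G E) = cst 0.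
  by apply/funext => y /=; case: ('oinv_ _ y).
have E0 : fderiv (0 : X -> sym_mlin k G E) x = 0.
  by apply: fderivE => v w; rewrite v0 diff_cst.
split; last exact: E0.
by split=> [|v w]; rewrite ?E0 v0 ?diff_cst.
Qed.

Lemma frechetD_lin p (X : set G) (a : R) (f g : X -> E) k :
  is_Cp p f -> is_Cp p g -> (k <= p)%N ->
  frechetD (a *: f + g) k = a *: frechetD f k + frechetD g k.
Proof.
move=> [fd _] [gd _]; elim: k => [_|k IHk kp].
  by apply/funext => x; apply: val_inj; apply/funext.
apply/funext => x /=; rewrite (IHk (ltnW kp)).
by have [_] := fderivable_lin a (fd _ kp x) (gd _ kp x).
Qed.

Lemma is_Cp_lin p (X : set G) (a : R) (f g : X -> E) :
  is_Cp p f -> is_Cp p g -> is_Cp p (a *: f + g).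
Proof.
move=> fp gp; have [fd fc] := fp; have [gd gc] := gp; split => k kp.
  move=> x; rewrite (frechetD_lin a fp gp (ltnW kp)).
  by have [] := fderivable_lin a (fd _ kp x) (gd _ kp x).
rewrite (frechetD_lin a fp gp kp) => x.
by apply: continuousD; [apply: continuousZl_tmp; exact: fc|exact: gc].
Qed.

Lemma frechetD0 (X : set G) k : frechetD (0 : X -> E) k = 0.
Proof.
elim: k => [|k IHk] /=; first by apply/funext => x; apply: val_inj; apply/funext.
by rewrite IHk; apply/funext => x; have [] := fderiv0 k x.
Qed.

Lemma is_Cp0 p (X : set G) : is_Cp p (0 : X -> E).
Proof.
split=> k _; last by rewrite frechetD0; exact: cst_continuous.
by move=> x; rewrite frechetD0; have [] := fderiv0 k x.
Qed.

Definition Cp_pred (p : nat) (X : set G) : pred (X -> E) :=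
  fun f => `[< is_Cp p f >].

End CpSpace.

Record Cp {R : realType} {G : normedModType R} (p : nat) (X : set G)
    (E : normedModType R) := MkCp {
  Cp_fun :> X -> E ;
  CpP : Cp_fun \in @Cp_pred R G E p X }.

Section CpTopology.
Context {R : realType} {G : normedModType R}.
Variables (p : nat) (X : set G) (E : normedModType R).

HB.instance Definition _ := [isSub for @Cp_fun R G p X E].
HB.instance Definition _ := [Choice of Cp p X E by <:].

Lemma Cp_submod_closed : submod_closed (@Cp_pred R G E p X).
Proof.
split; first by apply/asboolP; exact: is_Cp0.
by move=> a f g /asboolP fp /asboolP gp; apply/asboolP; exact: is_Cp_lin.
Qed.

HB.instance Definition _ :=
  GRing.isSubmodClosed.Build R (X -> E) (@Cp_pred R G E p X) Cp_submod_closed.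
HB.instance Definition _ := [SubChoice_isSubLmodule of Cp p X E by <:].

Definition Cp_seminorm (K : set X) (k : nat) (f : Cp p X E) : R :=
  sup [set sup [set `|frechetD f j x| | j in [set j | (j <= k)%N]] | x in K].

(* The balls of all the seminorms, with arbitrary centres, form a subbase of
   the topology generated by the seminorms. *)
Definition Cp_subbase : set (set (Cp p X E)) :=
  [set B | exists K k f e, [/\ compact K, (k <= p)%N, 0 < e &
             B = [set g | Cp_seminorm K k (g - f) < e]]].

HB.instance Definition _ :=
  isSubBaseTopological.Build (Cp p X E) Cp_subbase id.

End CpTopology.

Section WeakCompactness.
Context {R : realType}.

Definition top_dual (V : preTopologicalLmodType R) : Type :=
  {l : {scalar V} | continuous l}.

HB.instance Definition _ (V : preTopologicalLmodType R) :=
  gen_eqMixin (top_dual V).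
HB.instance Definition _ (V : preTopologicalLmodType R) :=
  gen_choiceMixin (top_dual V).

(* V with the initial topology for its continuous linear functionals. *)
Definition weak_topology_on (V : preTopologicalLmodType R) : Type :=
  initial_topology
    ((fun v l => sval l v) : V -> {ptws top_dual V -> R}).

HB.instance Definition _ (V : preTopologicalLmodType R) :=
  Topological.on (weak_topology_on V).

Definition weakly_compact (V W : preTopologicalLmodType R) (T : V -> W) : Prop :=
  exists U : set V, [/\ open U, U !=set0 &
    precompact (T @` U : set (weak_topology_on W))].

End WeakCompactness.

Section Separating.
Context {R : realType} {G H E F : normedModType R}.
Variables (p : nat) (X : set G) (Y : set H).

Definition disjoint_fun (S : Type) (V : zmodType) (f g : S -> V) : Prop :=
  forall x, f x = 0 \/ g x = 0.

Definition separating (T : Cp p X E -> Cp p Y F) : Prop :=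
  forall f g : Cp p X E, disjoint_fun f g -> disjoint_fun (T f) (T g).

Definition nowhere_trivial (T : Cp p X E -> Cp p Y F) : Prop :=
  forall y : Y, exists f, T f y != 0.

End Separating.

Definition has_bump {R : realType} (p : nat) (G : normedModType R) : Prop :=
  exists phi : Cp p [set: G] R,
    [/\ forall x : [set: G], `|\val x| <= 2^-1 -> phi x = 1,
        forall x : [set: G], 1 <= `|\val x| -> phi x = 0 &
        forall k, (k <= p)%N -> exists M : R, forall x, `|frechetD phi k x| <= M].

Section SupportMap.
Context {R : realType} {G H : normedModType R}.
Variables (p : nat) (X : set G) (Y : set H) (E F : normedModType R).

(* [Some] embeds R into its one-point compactification. *)
Definition AX_embed (x : X) : {ptws Cp p X R -> one_point_compactification R} :=
  fun psi => Some (psi x).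

Definition AX : set {ptws Cp p X R -> one_point_compactification R} :=
  closure (range AX_embed).

Lemma AX_embedP x : AX_embed x \in AX.
Proof. by apply/mem_set/subset_closure; exists x. Qed.

Definition AX_incl (x : X) : AX := exist _ (AX_embed x) (AX_embedP x).

(* [AX] is used as a type carrying the subspace topology, so that [open] and
   [closure] below are relative to it. *)
Definition closed_carrier (f : Cp p X E) : set AX :=
  closure (AX_incl @` [set x | f x != 0]).

Definition support_nbhs (T : Cp p X E -> Cp p Y F) (y : Y) : set (set AX) :=
  [set U | open U /\ exists2 f, T f y != 0 & closed_carrier f `<=` U].

(* The point of AX attached to y is the image of h y in AX. *)
Definition is_support_map (T : Cp p X E -> Cp p Y F) (h : Y -> X) : Prop :=
  forall y, \bigcap_(U in support_nbhs T y) closure U = [set AX_incl (h y)].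

End SupportMap.

(* Main.v *)
Require Import Defs.
From HB Require Import structures.
From mathcomp Require Import all_boot all_order all_fingroup all_algebra.
From mathcomp Require Import all_classical all_reals all_analysis.
From mathcomp Require Import ring lra zify.
Import Order.TTheory GRing.Theory Num.Theory.
Import numFieldNormedType.Exports.
Local Open Scope classical_set_scope.
Local Open Scope ring_scope.

Set Implicit Arguments.
Unset Strict Implicit.
Unset Printing Implicit Defensive.

(** The idea of the proof.

    Existence of [h y]. Weak compactness makes [T f y] depend on the derivatives
    of [f] on one compact set [K] only. Cover [K] by finitely many small balls
    and multiply by bumps: some point [h y] of [K] is such that every ball
    around it supports some [f] with [T f y != 0] ([exists_support_point]). As
    [T] is separating, [T f y = 0] as soon as [f] vanishes near [h y]
    ([supports_local]); so [h] is continuous, and [h y] is the only point of the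
    intersection that defines the support map ([supports_is_support_map]).

    Cutting. Let [l] be a continuous linear functional on [G] and let
    [s := l \o h]. The function [(l - a)_+ ^ p * f] is in general not of class
    C^p, but it is a limit of functions bounded in C^p. By weak compactness their
    images have a cluster point, and so the function that equals
    [T ((l - a) ^ p * f)] where [s > a], and 0 where [s <= a], is again of class
    C^p, at least after composition with functionals on [F] ([cut_in_Cp]).
    Consequently, where [s] crosses the level [a] in both directions along a
    line, all derivatives of order at most [p] of [T ((l - a) ^ p * f)] along
    that line vanish.

    Local constancy. Suppose that [T f] has no zero near [y0] and that [h] takes
    another value at a point [y1] near [y0]; a norming functional [l] gives [s]
    different values at both. On the segment from [y0] to [y1] there are then
    crossings [z n] tending to some [t1] with [s t1 - s (z n) >= c * (t1 - z n)],
    [c > 0] ([crossing_sequence]). Write [W j] for [T ((l - s t1) ^ j * f)] on the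
    segment and [e n := s t1 - s (z n)]. Expanding [(l - s (z n)) ^ p] in powers
    of [l - s t1] yields
      [\sum_i 'C(p, i) * e n ^ i * (W (p - i))^(k) (z n) = 0] for all [k <= p].
    Since [t1 - z n] is of order at most [e n], these relations and Taylor
    expansion make [W p], [W (p - 1)], ..., [W 0] vanish at [t1] one after the
    other ([vanishing_cascade]). But [W 0] is [T f], a contradiction
    ([support_locally_constant]).

    To multiply functions of class C^p, their derivatives are encoded as
    functions of the list of the directions ([is_jet]): the product rule becomes
    the recursion [leibniz], and symmetry is invariance under permutation. *)

(** * Norming functionals *)

Section HahnBanach.
Context {R : realType} {V : normedModType R}.
Implicit Types (A : set (V * R)) (u v w : V) (a b c t : R).

(** Graphs of linear functionals, on a subspace of [V], dominated by the norm;
    single-valuedness follows from the domination. *)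
Definition dominated_graph A :=
  (forall u a v b c, A (u, a) -> A (v, b) -> A (c *: u + v, c * a + b)) /\
  (forall u a, A (u, a) -> a <= `|u|).

Lemma dominated_graph0 A u a : dominated_graph A -> A (u, a) -> A (0, 0).
Proof.
move=> [Al _] Aua; have := Al _ _ _ _ (-1) Aua Aua.
by rewrite scaleN1r mulN1r !addNr.
Qed.

Lemma dominated_graphZ A u a c : dominated_graph A -> A (u, a) ->
  A (c *: u, c * a).
Proof.
move=> Ag Aua; have A0 := dominated_graph0 Ag Aua.
by have := Ag.1 _ _ _ _ c Aua A0; rewrite !addr0.
Qed.

Lemma dominated_graph_fun A u a b : dominated_graph A ->
  A (u, a) -> A (u, b) -> a = b.
Proof.
move=> [Al Ab].
have H x y : A (u, x) -> A (u, y) -> x <= y.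
  move=> Ax Ay; have /Ab := Al _ _ _ _ (-1) Ay Ax.
  by rewrite scaleN1r addNr normr0 mulN1r addrC subr_le0.
by move=> Aa Ab'; apply/eqP; rewrite eq_le !H.
Qed.

(** One-dimensional extension: the value at [v] is squeezed between
    [a - |u - v|] and [|w + v| - b], for [(u, a)] and [(w, b)] in the graph. *)
Lemma dominated_graph_extend A v : dominated_graph A -> A !=set0 ->
  exists B c, [/\ dominated_graph B, A `<=` B & B (v, c)].
Proof.
move=> Ag [[u0 a0] A0]; have A00 := dominated_graph0 Ag A0.
have [Al Ab] := Ag.
pose S := [set z | exists u a, A (u, a) /\ z = a - `|u - v|].
have lo_up u a w b : A (u, a) -> A (w, b) -> a - `|u - v| <= `|w + v| - b.
  move=> Aua Awb; rewrite lerBlDr addrAC lerBrDr.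
  have := Al _ _ _ _ 1 Aua Awb; rewrite scale1r mul1r => /Ab/le_trans; apply.
  have -> : u + w = (w + v) + (u - v) by rewrite [RHS]addrC -addrA (addrC w) addKr.
  exact: ler_normD.
have Ssup : has_sup S.
  split; first by exists (0 - `|0 - v|), 0, 0.
  exists (`|0 + v| - 0) => _ [u [a [Aua ->]]]; exact: lo_up.
pose c := sup S.
have cge u a : A (u, a) -> a - `|u - v| <= c.
  by move=> Aua; apply: (sup_upper_bound Ssup); exists u, a.
have cle w b : A (w, b) -> c <= `|w + v| - b.
  move=> Awb; apply: ge_sup; first exact: Ssup.1.
  by move=> _ [u [a [Aua ->]]]; exact: lo_up.
exists [set z | exists u a t, A (u, a) /\ z = (u + t *: v, a + t * c)], c.
split; last 1 first.
- by exists 0, 0, 1; rewrite !add0r scale1r mul1r.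
- split.
    move=> _ _ _ _ k [u [a [t [Aua [-> ->]]]]] [w [b [r [Awb [-> ->]]]]].
    exists (k *: u + w), (k * a + b), (k * t + r); split; first exact: Al.
    congr pair; last by ring.
    by rewrite scalerDr scalerDl addrACA scalerA.
  move=> _ _ [u [a [t [Aua [-> ->]]]]].
  have [t0|t0|->] := ltgtP t 0; last by rewrite scale0r mul0r !addr0 Ab.
  - have := cge _ _ (dominated_graphZ (- t)^-1 Ag Aua).
    have nt0 : 0 < - t by rewrite oppr_gt0.
    have -> : (- t)^-1 *: u - v = (- t)^-1 *: (u + t *: v).
      by rewrite scalerDr scalerA invrN mulNr mulVf ?lt_eqF// scaleN1r.
    by rewrite normrZ gtr0_norm ?invr_gt0// -mulrBr ler_pdivrMl//; lra.
  - have := cle _ _ (dominated_graphZ t^-1 Ag Aua).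
    have -> : t^-1 *: u + v = t^-1 *: (u + t *: v).
      by rewrite scalerDr scalerA mulVf ?gt_eqF// scale1r.
    by rewrite normrZ gtr0_norm ?invr_gt0// -mulrBr ler_pdivlMl//; lra.
- by move=> [u a] Aua; exists u, a, 0; rewrite scale0r mul0r !addr0.
Qed.

(** Zorn's lemma: a maximal dominated graph is total, as it could otherwise be
    extended. The empty graph is admitted so that empty chains are bounded. *)
Lemma hahn_banach_norming (x : V) : exists l : {linear V -> R},
  l x = `|x| /\ forall v, `|l v| <= `|v|.
Proof.
pose P A := A !=set0 -> dominated_graph A /\ A (x, `|x|).
have totP F : F `<=` P -> total_on F subset -> P (\bigcup_(A in F) A).
  move=> FP Ft [z0 [A0 FA0 A0z]].
  have [A0g A0x] := FP _ FA0 (ex_intro _ z0 A0z).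
  split; last by exists A0.
  split=> [u a v b c [A FA Aua] [B FB Bvb]|u a [A FA Aua]]; last first.
    by have [[_ Ab] _] := FP _ FA (ex_intro _ _ Aua); exact: Ab.
  have [AB|BA] := Ft _ _ FA FB.
    have [[Bl _] _] := FP _ FB (ex_intro _ _ Bvb).
    by exists B => //; apply: Bl => //; exact: AB.
  have [[Al _] _] := FP _ FA (ex_intro _ _ Aua).
  by exists A => //; apply: Al => //; exact: BA.
have [A [PA Amax]] := Zorn_bigcup totP.
have A0 : A !=set0.
  apply: contrapT => /set0P/negP; rewrite negbK => /eqP A0.
  apply: (Amax [set z | exists t, z = (t *: x, t * `|x|)]).
    by rewrite A0 properEneq; split=> //; apply/eqP => /seteqP[_ /(_ (0, 0))]; apply;
      exists 0; rewrite scale0r mul0r.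
  move=> _; split; last by exists 1; rewrite scale1r mul1r.
  split=> [_ _ _ _ c [t [-> ->]] [s [-> ->]]|_ _ [t [-> ->]]].
    by exists (c * t + s); rewrite scalerDl scalerA mulrDl mulrA.
  by rewrite normrZ ler_wpM2r// ler_norm.
have [Ag Ax] := PA A0.
have Atot v : exists a, A (v, a).
  apply: contrapT => nA.
  have [B [c [Bg AB Bvc]]] := dominated_graph_extend v Ag A0.
  apply: (Amax B); last by move=> _; split=> //; exact: AB.
  split=> // BA; apply: nA; exists c; exact: BA.
have [f Af] := choice Atot.
have fl : linear f.
  move=> c u v; apply: (dominated_graph_fun Ag (Af _)).
  exact: Ag.1.
pose L := GRing.isLinear.Build _ _ _ _ f fl.
pose l : {linear V -> R} := HB.pack f L.
exists l; split; first exact: (dominated_graph_fun Ag (Af _)).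
have fle v : f v <= `|v| by apply: Ag.2; exact: Af.
move=> v; rewrite ler_norml fle andbT lerNl.
by have := fle (- v); rewrite normrN -[f (- v)]/(l (- v)) linearN.
Qed.

End HahnBanach.

(** * Multilinear maps on lists *)

Section ListMultilinear.
Context {R : realType} {G E : normedModType R}.
Implicit Types (beta : seq G -> E) (s t : seq G) (u v : G) (c M : R) (k : nat).

Definition nprod s : R := \prod_(v <- s) `|v|.

Lemma nprod_ge0 s : 0 <= nprod s.
Proof. by apply: prodr_ge0. Qed.

Lemma nprod_cons v s : nprod (v :: s) = `|v| * nprod s.
Proof. by rewrite /nprod big_cons. Qed.

(** Symmetric bounded multilinear maps of all degrees at once, as functions of
    the list of their arguments: consing replaces the coercions between
    degrees, and linearity in the first argument suffices by symmetry. *)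
Record multilin beta : Prop := Multilin {
  multilin_perm : forall s t, perm_eq s t -> beta s = beta t;
  multilin_head : forall c u v s,
    beta (c *: u + v :: s) = c *: beta (u :: s) + beta (v :: s);
  multilin_bdd : forall k, exists2 M, 0 <= M &
    forall s, size s = k -> `|beta s| <= M * nprod s }.

Definition norm_le k beta M := forall s, size s = k -> `|beta s| <= M * nprod s.

Lemma multilin_cons beta v : multilin beta -> multilin (beta \o cons v).
Proof.
case=> bp bl bb; split=> [s t st|c u w s|k] /=.
- by apply: bp; rewrite perm_cons.
- have sw x : beta [:: v, x & s] = beta [:: x, v & s].
    by apply: bp; rewrite -[_ :: _]/([:: v] ++ [:: x] ++ s) perm_catCA.
  by rewrite !sw bl.
- have [M M0 bM] := bb k.+1; exists (M * `|v|); first by rewrite mulr_ge0.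
  by move=> s sk; rewrite -mulrA -nprod_cons bM//= sk.
Qed.

Lemma multilin_headZ beta c u s : multilin beta ->
  beta (c *: u :: s) = c *: beta (u :: s).
Proof.
move=> [_ bl _].
have b0 : beta (0 :: s) = 0.
  by have := bl (-1) 0 0 s; rewrite scaler0 addr0 scaleN1r addNr.
by have := bl c u 0 s; rewrite addr0 b0 addr0.
Qed.

Lemma multilin_mem0 beta s : multilin beta -> 0 \in s -> beta s = 0.
Proof.
move=> bm s0; rewrite (multilin_perm bm (perm_to_rem s0)).
by have := multilin_headZ 0 0 (rem 0 s) bm; rewrite !scale0r.
Qed.

(** The unit ball determines the norm: rescale the arguments one by one. *)
Lemma norm_le_ball k beta M : multilin beta -> 0 <= M ->
  (forall s, size s = k -> (forall v, v \in s -> `|v| <= 1) -> `|beta s| <= M) ->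
  norm_le k beta M.
Proof.
move=> bm M0 bM.
suff H t s : size (t ++ s) = k -> (forall v, v \in s -> `|v| <= 1) ->
    `|beta (t ++ s)| <= M * nprod t.
  by move=> s sk; have := H s [::]; rewrite cats0; apply.
elim: t s => [|v t IHt] s /= sk s1.
  by rewrite /nprod big_nil mulr1 bM.
have [->|v0] := eqVneq v 0.
  by rewrite multilin_mem0 ?mem_head// normr0 mulr_ge0// nprod_ge0.
have nv : 0 < `|v| by rewrite normr_gt0.
rewrite -[in leLHS](scale1r v) -(divff (lt0r_neq0 nv)) -scalerA multilin_headZ//.
rewrite normrZ normr_id nprod_cons mulrCA ler_wpM2l//.
have <- : beta (t ++ (`|v|^-1 *: v :: s)) = beta (`|v|^-1 *: v :: t ++ s).
  apply: (multilin_perm bm).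
  by rewrite perm_sym -(cat1s _ (t ++ s)) perm_catCA.
apply: IHt => [|w]; first by rewrite -sk !size_cat addnS.
rewrite inE => /predU1P[->|]; last exact: s1.
by rewrite normrZ normfV normr_id mulVf ?gt_eqF.
Qed.

Lemma map_nth_seq k (v : 'I_k -> G) (i : 'I_k) : nth 0 [seq v i | i : 'I_k] i = v i.
Proof.
by rewrite (nth_map i) ?size_enum_ord// nth_ord_enum.
Qed.

Lemma nprod_ord k (v : 'I_k -> G) : nprod [seq v i | i : 'I_k] = \prod_i `|v i|.
Proof. by rewrite /nprod big_map big_enum. Qed.

Lemma nprod_nth s : \prod_(i < size s) `|nth 0 s i| = nprod s.
Proof. by rewrite /nprod (big_nth 0) big_mkord. Qed.

Lemma map_dfwith k (v : 'I_k -> G) (i : 'I_k) (x : G) :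
  perm_eq [seq dfwith v i x j | j : 'I_k]
          (x :: [seq v j | j <- rem i (enum 'I_k)]).
Proof.
have := perm_map (fun j => dfwith v i x j) (perm_to_rem (mem_enum 'I_k i)).
move=> /perm_trans; apply => /=; rewrite dfwithin perm_cons.
have -> : [seq dfwith v i x j | j <- rem i (enum 'I_k)] =
    [seq v j | j <- rem i (enum 'I_k)]; last exact: perm_refl.
apply/eq_in_map => j; rewrite mem_rem_uniq ?enum_uniq// inE => /andP[ji _].
by rewrite dfwithout// eq_sym.
Qed.

Lemma mlin_of_subproof k beta : multilin beta ->
  (fun v : 'I_k -> G => beta [seq v i | i : 'I_k]) \in @sym_mlin_pred R k G E.
Proof.
move=> bm; apply/asboolP; split.
- move=> v i a x y; rewrite !(multilin_perm bm (map_dfwith v i _)).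
  by rewrite (multilin_head bm).
- move=> v s; apply: (multilin_perm bm); rewrite /image_mem (map_comp v s).
  apply: (perm_map v); apply: uniq_perm; rewrite ?enum_uniq//.
    by rewrite map_inj_uniq ?enum_uniq//; exact: perm_inj.
  move=> i; rewrite mem_enum; apply/mapP; exists ((s^-1)%g i).
    by rewrite mem_enum.
  by rewrite permKV.
- have [M M0 bM] := multilin_bdd bm k; exists M => v.
  by rewrite -nprod_ord bM// size_image card_ord.
Qed.

Definition mlin_of k beta (bm : multilin beta) : sym_mlin k G E :=
  SymMlin (mlin_of_subproof k bm).

Lemma mlin_ofE k beta (bm : multilin beta) (v : 'I_k -> G) :
  mlin_of k bm v = beta [seq v i | i : 'I_k].
Proof. by []. Qed.

Lemma norm_mlin_of k beta (bm : multilin beta) M : 0 <= M ->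
  norm_le k beta M -> `|mlin_of k bm| <= M.
Proof.
move=> M0 bM; apply: op_norm_le => v v1; rewrite mlin_ofE.
apply: le_trans (bM _ _) _; first by rewrite size_image card_ord.
rewrite ler_piMr// nprod_ord prodr_ile1// => i _; rewrite normr_ge0 /=; exact: v1.
Qed.

Definition list_of (A : forall k, sym_mlin k G E) s : E :=
  A (size s) (fun i => nth 0 s i).

Lemma list_ofE A k s : size s = k -> list_of A s = A k (fun i => nth 0 s i).
Proof. by move=> <-. Qed.

Lemma list_of_map A k (v : 'I_k -> G) : list_of A [seq v i | i : 'I_k] = A k v.
Proof.
rewrite (@list_ofE A k) ?size_image ?card_ord//; apply: congr1.
by apply/funext => i; rewrite map_nth_seq.
Qed.

Lemma sym_mlin_multilin k (A : sym_mlin k G E) :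
  [/\ multilinear_map A, symmetric_map A & bounded_multilinear_map A].
Proof. by have /asboolP := sym_mlinP A. Qed.

Lemma multilin_list_of A : multilin (list_of A).
Proof.
split.
- move=> s t st; have sz := perm_size st.
  rewrite (@list_ofE A (size s))// (@list_ofE A (size s) t)//.
  have [_ As _] := sym_mlin_multilin (A (size s)).
  have : perm_eq (in_tuple s) (tcast (esym sz) (in_tuple t)).
    by rewrite val_tcast.
  move=> /tuple_permP[p sp]; rewrite -[RHS](As _ p); apply: congr1.
  apply/funext => i /=.
  have -> : nth 0 s i = tnth (in_tuple s) i by rewrite (tnth_nth 0).
  by rewrite (val_inj sp) tnth_mktuple (tnth_nth 0) val_tcast.
- move=> c u v s; have [Al _ _] := sym_mlin_multilin (A (size s).+1).
  have E1 x : list_of A (x :: s) =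
      A (size s).+1 (dfwith (fun i : 'I_(size s).+1 => nth 0 (0 :: s) i) ord0 x).
    rewrite /list_of /=; apply: congr1; apply/funext => i.
    by case: dfwithP => // -[[|j] ij].
  by rewrite !E1 Al.
- move=> k; have [_ _ [M AM]] := sym_mlin_multilin (A k).
  exists `|M|; rewrite ?normr_ge0// => s sk; rewrite (@list_ofE A k)//.
  rewrite (le_trans (AM _))// -sk nprod_nth ler_wpM2r// ?nprod_ge0//.
  exact: ler_norm.
Qed.

Lemma norm_list_of A k : norm_le k (list_of A) `|A k|.
Proof.
apply: norm_le_ball; [exact: multilin_list_of|exact: normr_ge0|].
move=> s sk s1; rewrite (@list_ofE A k)//; apply: op_norm_ub => i.
by apply: s1; rewrite mem_nth// sk.
Qed.

End ListMultilinear.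

(** * Jets of functions of class C^p *)

Section Extension.
Context {R : realType} {G : normedModType R}.
Variables (X : set G) (oX : open X).

Lemma valLE (W : lmodType R) (f : X -> W) (x : X) : 'valL_0 f (val x) = f x.
Proof.
by rewrite -[in RHS](@valLK _ W 0 X f).
Qed.

Lemma valP_ex (y : G) : X y -> exists z : X, val z = y.
Proof. by move=> Xy; exists (exist _ y (mem_set Xy)). Qed.

Lemma near_val (x : X) (P : set G) :
  (\forall y \near val x, P y) <-> (\forall z \near x, P (val z)).
Proof.
split=> [xP|].
  have : {for x, continuous (set_val : X -> G)} by exact: initial_continuous.
  exact.
move=> [_ [[B oB <-] Bx BP]].
have nB : nbhs (val x) B by apply: open_nbhs_nbhs; split.
have nX : nbhs (val x) X by apply: open_nbhs_nbhs; split=> //; exact: set_valP.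
apply: filterS (filterI nB nX) => y [By Xy].
by have [z zy] := valP_ex Xy; rewrite -zy; apply: BP; rewrite /= set_valE zy.
Qed.

End Extension.

Section DiffNear.
Context {R : realType} {V W : normedModType R}.
Implicit Types (f : V -> W) (x : V).

Lemma diff_nearP f x (df : {linear V -> W}) : continuous df ->
  (forall e : R, 0 < e ->
     \forall y \near x, `|f y - f x - df (y - x)| <= e * `|y - x|) ->
  differentiable f x /\ 'd f x = df :> (V -> W).
Proof.
move=> cdf fdf.
have H : f \o shift x = cst (f x) + df +o_ 0 id.
  apply/eqaddoP => e e0; rewrite [\forall h \near _, _ <= _](near_shift x).
  apply: filterS (fdf e e0) => y /=.
  by rewrite !fctE /= sub0r subrK opprD addrA.
have dE := diff_unique cdf H; split=> //.
by apply/diff_locallyP; rewrite dE.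
Qed.

Lemma diff_near f x : differentiable f x -> forall e : R, 0 < e ->
  \forall y \near x, `|f y - f x - 'd f x (y - x)| <= e * `|y - x|.
Proof.
move=> /diff_locally/eqaddoP fx e e0.
have := fx e e0; rewrite [\forall h \near _, _ <= _](near_shift x).
by apply: filterS => y /=; rewrite !fctE /= sub0r subrK opprD addrA.
Qed.

End DiffNear.

Section Jets.
Context {R : realType} {G E : normedModType R}.
Implicit Types (X : set G) (alpha : G -> seq G -> E) (p k : nat).

(** The derivatives of all orders at most [p] of a function on [X], each a
    multilinear map in list form, with the estimates that make every one of
    them the Frechet derivative of the previous one. *)
Record is_jet p X alpha : Prop := IsJet {
  jet_multilin : forall x, multilin (alpha x);
  jet_diff : forall k x, (k < p)%N -> X x -> forall e : R, 0 < e ->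
    \forall y \near x,
      norm_le k (fun s => alpha y s - alpha x s - alpha x (y - x :: s))
        (e * `|y - x|);
  jet_cont : forall k x, (k <= p)%N -> X x -> forall e : R, 0 < e ->
    \forall y \near x, norm_le k (fun s => alpha y s - alpha x s) e }.

Lemma map_vcons k v (w : 'I_k -> G) :
  [seq vcons v w i | i : 'I_k.+1] = v :: [seq w i | i : 'I_k].
Proof.
rewrite /image_mem enum_ordSl /= /vcons unlift_none; congr cons.
by rewrite -map_comp; apply: eq_map => i /=; rewrite liftK.
Qed.

Lemma nth_cons_vcons v (s : seq G) :
  (fun i : 'I_(size s).+1 => nth 0 (v :: s) i) = vcons v (fun i => nth 0 s i).
Proof.
apply/funext => i; rewrite /vcons.
by case: unliftP => [j|] -> //=.
Qed.

Lemma norm_sym_mlin_le k (D : sym_mlin k G E) (beta : seq G -> E) (M : R) :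
  0 <= M -> norm_le k beta M ->
  (forall v, D v = beta [seq v i | i : 'I_k]) -> `|D| <= M.
Proof.
move=> M0 bM DE; apply: op_norm_le => v v1; rewrite DE.
apply: le_trans (bM _ _) _; first by rewrite size_image card_ord.
by rewrite ler_piMr// nprod_ord prodr_ile1// => i _; rewrite normr_ge0 /=; exact: v1.
Qed.

Section JetToCp.
Variables (p : nat) (X : set G) (oX : open X) (alpha : G -> seq G -> E).
Hypothesis aJ : is_jet p X alpha.

Let A k (x : G) : sym_mlin k G E := mlin_of k (jet_multilin aJ x).

Lemma jet_contract_subproof k x :
  linear (fun v => mlin_of k (multilin_cons v (jet_multilin aJ x)) : sym_mlin k G E).
Proof.
move=> c u v; apply: val_inj; apply/funext => w /=.
exact: (multilin_head (jet_multilin aJ x)).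
Qed.

Let contract k x : {linear G -> sym_mlin k G E} :=
  let L := GRing.isLinear.Build _ _ _ _ _ (jet_contract_subproof k x) in
  HB.pack (fun v => mlin_of k (multilin_cons v (jet_multilin aJ x)) : sym_mlin k G E) L.

Let contract_continuous k x : continuous (contract k x).
Proof.
apply: bounded_linear_continuous; apply/linear_boundedP.
have [M M0 aM] := multilin_bdd (jet_multilin aJ x) k.+1.
exists M; split=> [|r Mr v]; first exact: num_real.
rewrite -[contract k x v]/(mlin_of k (multilin_cons v (jet_multilin aJ x))).
apply: norm_mlin_of; first by rewrite mulr_ge0// (le_trans M0)// ltW.
move=> s sk; rewrite -mulrA -nprod_cons.
have := aM (v :: s); rewrite /= sk => /(_ erefl)/le_trans; apply.
by rewrite ler_wpM2r ?nprod_ge0// ltW.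
Qed.

Let contractE k x v w : contract k x v w = A k.+1 x (vcons v w).
Proof.
exact: (congr1 (alpha x) (esym (map_vcons v w))).
Qed.

Let fderiv_jet k (x : X) : (k < p)%N ->
  fderivable (fun x : X => A k (val x)) x /\
  fderiv (fun x : X => A k (val x)) x = A k.+1 (val x).
Proof.
move=> kp; set F := fun x : X => A k (val x).
have Xx : X (val x) := set_valP x.
have [dF dE] : differentiable ('valL_0 F) (val x) /\
    'd ('valL_0 F) (val x) = contract k (val x) :> (G -> sym_mlin k G E).
  apply: diff_nearP => [|e e0]; first exact: contract_continuous.
  have nX : nbhs (val x) X by apply: open_nbhs_nbhs; split.
  apply: filterS (filterI nX (jet_diff aJ kp Xx e0)) => y [Xy ya].
  have [z zy] := valP_ex Xy; rewrite -{}zy in ya *; rewrite !valLE.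
  by apply: (norm_sym_mlin_le _ ya) => //; rewrite mulr_ge0// ltW.
have E1 : fderiv F x = A k.+1 (val x).
  by apply: fderivE => v w; rewrite dE contractE.
by split=> //; split=> // v w; rewrite E1 dE contractE.
Qed.

Lemma frechetD_jet k : (k <= p)%N ->
  frechetD (fun x : X => alpha (val x) [::]) k =
  (fun x : X => mlin_of k (jet_multilin aJ (val x))).
Proof.
elim: k => [_|k IHk kp].
  apply/funext => x; apply: val_inj; apply/funext => v /=.
  by rewrite /image_mem (size0nil (size_enum_ord 0)).
by apply/funext => x /=; rewrite (IHk (ltnW kp)); have [] := fderiv_jet x kp.
Qed.

Lemma jet_is_Cp : is_Cp p (fun x : X => alpha (val x) [::]).
Proof.
split=> k kp.
  by move=> x; rewrite frechetD_jet ?(ltnW kp)//; have [] := fderiv_jet x kp.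
rewrite frechetD_jet// => x.
apply/(@cvgrPdist_le _ _ _ (nbhs x) (nbhs_filter x)) => e e0.
have /(near_val oX x) H := jet_cont aJ kp (set_valP x) e0.
move: H; apply: (@filterS _ (nbhs x)) => z za; rewrite distrC.
by apply: (norm_sym_mlin_le _ za) => //; exact: ltW.
Qed.

End JetToCp.

(** The derivatives of [f], extended by 0 outside [X]. *)
Definition jet_of X (f : X -> E) (x : G) (s : seq G) : E :=
  list_of (fun k => 'valL_0 (frechetD f k) x) s.

Lemma jet_of_size X (f : X -> E) (x : X) k (s : seq G) : size s = k ->
  jet_of f (val x) s = frechetD f k x (fun i => nth 0 s i).
Proof. by move=> <-; rewrite /jet_of /list_of valLE. Qed.

Lemma jet_of_nil X (f : X -> E) (x : X) : jet_of f (val x) [::] = f x.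
Proof. by rewrite /jet_of /list_of valLE. Qed.

Lemma jet_of_is_jet p X (f : X -> E) : open X -> is_Cp p f ->
  is_jet p X (jet_of f).
Proof.
move=> oX [fd fc]; split=> [x|k x kp Xx e e0|k x kp Xx e e0].
- exact: multilin_list_of.
- have [z zx] := valP_ex Xx; have [dF dE] := fd k kp z; rewrite zx in dF dE.
  apply: filterS (diff_near dF e0) => y ye s sk; rewrite -sk in ye dE *.
  have yE : jet_of f x (y - x :: s) =
     'd ('valL_0 (frechetD f (size s))) x (y - x) (fun i => nth 0 s i).
    rewrite -dE -[LHS]/('valL_0 (frechetD f (size s).+1) x
      (fun i : 'I_(size s).+1 => nth 0 (y - x :: s) i)).
    by rewrite -zx valLE nth_cons_vcons.
  pose D k := 'valL_0 (frechetD f k) y - 'valL_0 (frechetD f k) x -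
              'd ('valL_0 (frechetD f k)) x (y - x).
  have -> : jet_of f y s - jet_of f x s - jet_of f x (y - x :: s) = list_of D s.
    by rewrite yE.
  apply: le_trans (norm_list_of D erefl) _.
  by rewrite ler_wpM2r// nprod_ge0.
- have [z zx] := valP_ex Xx.
  have /cvgrPdist_le/(_ _ e0) := fc k kp z.
  pose D j y := 'valL_0 (frechetD f j) y - 'valL_0 (frechetD f j) x.
  move=> H; have : \forall t \near z, `|D k (val t)| <= e.
    by apply: filterS H => t; rewrite distrC /D -zx !valLE.
  move/(near_val oX z (fun y => `|D k y| <= e)); rewrite zx.
  apply: filterS => y ye s sk.
  rewrite -[X in `|X|]/(list_of (D^~ y) s).
  apply: le_trans (norm_list_of (D^~ y) sk) _.
  by rewrite ler_wpM2r// nprod_ge0.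
Qed.

End Jets.

(** * The product rule *)

Section Leibniz.
Context {R : realType} {G E : normedModType R}.
Implicit Types (a : seq G -> R) (b : seq G -> E) (s t : seq G) (k n : nat).

(** The product rule for all orders: every argument goes to exactly one of the
    two factors. *)
Fixpoint leibniz a b s : E :=
  if s is v :: s' then leibniz (a \o cons v) b s' + leibniz a (b \o cons v) s'
  else a [::] *: b [::].

Lemma leibniz_linl a a' b (c : R) s :
  leibniz (fun t => c * a t + a' t) b s = c *: leibniz a b s + leibniz a' b s.
Proof.
elim: s a a' b => [|v s IHs] a a' b /=; first by rewrite scalerDl scalerA.
rewrite -[(fun t => c * a t + a' t) \o cons v]/
  (fun t => c * (a \o cons v) t + (a' \o cons v) t).
by rewrite !IHs scalerDr addrACA.
Qed.

Lemma leibniz_linr a b b' (c : R) s :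
  leibniz a (fun t => c *: b t + b' t) s = c *: leibniz a b s + leibniz a b' s.
Proof.
elim: s a b b' => [|v s IHs] a b b' /=.
  by rewrite scalerDr !scalerA mulrC.
rewrite -[(fun t => c *: b t + b' t) \o cons v]/
  (fun t => c *: (b \o cons v) t + (b' \o cons v) t).
by rewrite !IHs scalerDr addrACA.
Qed.

Lemma leibnizBl a a' b s :
  leibniz (fun t => a t - a' t) b s = leibniz a b s - leibniz a' b s.
Proof.
have := leibniz_linl a' a b (-1) s; rewrite scaleN1r addrC => <-.
by congr leibniz; apply/funext => t; rewrite mulN1r addrC.
Qed.

Lemma leibnizBr a b b' s :
  leibniz a (fun t => b t - b' t) s = leibniz a b s - leibniz a b' s.
Proof.
have := leibniz_linr a b' b (-1) s; rewrite scaleN1r addrC => <-.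
by congr leibniz; apply/funext => t; rewrite scaleN1r addrC.
Qed.

Lemma multilin_swap (W : normedModType R) (b : seq G -> W) v w :
  multilin b -> b \o cons v \o cons w = b \o cons w \o cons v.
Proof.
move=> bm; apply/funext => s /=; apply: (multilin_perm bm).
by rewrite -[[:: v, w & s]]/([:: v] ++ [:: w] ++ s) perm_catCA.
Qed.

Lemma leibniz_front a b t v s : multilin a -> multilin b ->
  leibniz a b (t ++ v :: s) = leibniz a b (v :: t ++ s).
Proof.
elim: t a b => [//|w t IHt] a b am bm.
rewrite [LHS]/= !IHt//; try exact: multilin_cons.
rewrite /= (multilin_swap w v am) (multilin_swap w v bm).
by rewrite addrACA.
Qed.

Lemma leibniz_perm a b s t : multilin a -> multilin b -> perm_eq s t ->
  leibniz a b s = leibniz a b t.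
Proof.
elim: s t a b => [|v s IHs] t a b am bm st.
  by have /perm_nilP -> : perm_eq t [::] by rewrite perm_sym.
have : v \in t by rewrite -(perm_mem st) mem_head.
move: st => /[swap] /splitPr[t1 t2] st; rewrite leibniz_front//=.
have st' : perm_eq s (t1 ++ t2).
  by rewrite -(perm_cons v) (perm_trans st)// -cat_rcons -cats1 -catA perm_catCA.
by congr (_ + _); apply: IHs => //; exact: multilin_cons.
Qed.

Lemma leibniz_norm a b s (M N : R) : 0 <= M -> 0 <= N ->
  (forall k, (k <= size s)%N -> norm_le k a M) ->
  (forall k, (k <= size s)%N -> norm_le k b N) ->
  `|leibniz a b s| <= 2 ^+ size s * (M * N) * nprod s.
Proof.
elim: s a b M N => [|v s IHs] a b M N M0 N0 aM bN /=.
  rewrite /nprod big_nil mulr1 mul1r normrZ ler_pM//.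
    by have := aM 0%N erefl [::] erefl; rewrite /nprod big_nil mulr1.
  by have := bN 0%N erefl [::] erefl; rewrite /nprod big_nil mulr1.
have cons_le (W : normedModType R) (c : seq G -> W) K :
    (forall k, (k <= (size s).+1)%N -> norm_le k c K) ->
    forall k, (k <= size s)%N -> norm_le k (c \o cons v) (K * `|v|).
  move=> cK k ks t tk; rewrite -mulrA -nprod_cons.
  by apply: (cK k.+1 _ (v :: t)) => //=; rewrite tk.
have H1 := IHs (a \o cons v) b _ _ (mulr_ge0 M0 (normr_ge0 v)) N0
  (cons_le _ _ _ aM) (fun k ks => bN k (leqW ks)).
have H2 := IHs a (b \o cons v) _ _ M0 (mulr_ge0 N0 (normr_ge0 v))
  (fun k ks => aM k (leqW ks)) (cons_le _ _ _ bN).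
apply: le_trans (ler_normD _ _) _; apply: le_trans (lerD H1 H2) _.
rewrite nprod_cons exprS le_eqVlt; apply/orP; left; apply/eqP; ring.
Qed.

Lemma multilin_bdd_le (W : normedModType R) (b : seq G -> W) n : multilin b ->
  exists2 M, 0 <= M & forall k, (k <= n)%N -> norm_le k b M.
Proof.
move=> bm; elim: n => [|n [M M0 bM]].
  by have [M M0 bM] := multilin_bdd bm 0; exists M => // k; rewrite leqn0 => /eqP ->.
have [N N0 bN] := multilin_bdd bm n.+1; exists (M + N); first exact: addr_ge0.
move=> k; rewrite leq_eqVlt => /predU1P[->|kn] s sk; rewrite mulrDl.
  by rewrite (le_trans (bN s sk))// lerDr mulr_ge0// nprod_ge0.
by rewrite (le_trans (bM k kn s sk))// lerDl mulr_ge0// nprod_ge0.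
Qed.

Lemma multilin_leibniz a b : multilin a -> multilin b -> multilin (leibniz a b).
Proof.
move=> am bm; split=> [s t st|c u v s|k].
- exact: leibniz_perm.
- rewrite /=.
  have -> : a \o cons (c *: u + v) = (fun t => c * (a \o cons u) t + (a \o cons v) t).
    by apply/funext => t /=; rewrite (multilin_head am).
  have -> : b \o cons (c *: u + v) = (fun t => c *: (b \o cons u) t + (b \o cons v) t).
    by apply/funext => t /=; rewrite (multilin_head bm).
  by rewrite leibniz_linl leibniz_linr scalerDr addrACA.
- have [M M0 aM] := multilin_bdd_le k am; have [N N0 bN] := multilin_bdd_le k bm.
  exists (2 ^+ k * (M * N)); first by rewrite !mulr_ge0.
  by move=> s sk; rewrite -sk leibniz_norm// sk.
Qed.

End Leibniz.

Lemma telescope3 (V : zmodType) (a b c d u v : V) :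
  a - b - (c + d) = a - u - v + (v - c) + (u - b - d).
Proof.
have -> : a - u - v + (v - c) = a - c - u by rewrite addrA subrK addrAC.
by rewrite [RHS]addrA [in RHS]addrA subrK opprD addrA (addrAC a).
Qed.

Section JetProduct.
Context {R : realType} {G E : normedModType R}.
Variables (p : nat) (X : set G).

Lemma jet_diff_le (W : normedModType R) (alpha : G -> seq G -> W) k x (e : R) :
  is_jet p X alpha -> (k < p)%N -> X x -> 0 < e ->
  \forall y \near x, forall j, (j <= k)%N ->
    norm_le j (fun s => alpha y s - alpha x s - alpha x (y - x :: s)) (e * `|y - x|).
Proof.
move=> aJ kp Xx e0.
have H : \forall y \near x, forall j : 'I_k.+1,
    norm_le j (fun s => alpha y s - alpha x s - alpha x (y - x :: s)) (e * `|y - x|).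
  apply: filter_forall => j; apply: (jet_diff aJ) => //.
  by rewrite (leq_ltn_trans _ kp)// -ltnS.
by apply: filterS H => y H j jk; exact: (H (Ordinal (jk : (j < k.+1)%N))).
Qed.

Lemma jet_cont_le (W : normedModType R) (alpha : G -> seq G -> W) k x (e : R) :
  is_jet p X alpha -> (k <= p)%N -> X x -> 0 < e ->
  \forall y \near x, forall j, (j <= k)%N ->
    norm_le j (fun s => alpha y s - alpha x s) e.
Proof.
move=> aJ kp Xx e0.
have H : \forall y \near x, forall j : 'I_k.+1,
    norm_le j (fun s => alpha y s - alpha x s) e.
  apply: filter_forall => j; apply: (jet_cont aJ) => //.
  by rewrite (leq_trans _ kp)// -ltnS.
by apply: filterS H => y H j jk; exact: (H (Ordinal (jk : (j < k.+1)%N))).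
Qed.

Lemma jet_leibniz (alpha : G -> seq G -> R) (beta : G -> seq G -> E) :
  is_jet p X alpha -> is_jet p X beta ->
  is_jet p X (fun x => leibniz (alpha x) (beta x)).
Proof.
move=> aJ bJ.
have am x := jet_multilin aJ x; have bm x := jet_multilin bJ x.
split=> [x|k x kp Xx e e0|k x kp Xx e e0].
- exact: multilin_leibniz.
- have [M M0 aM] := multilin_bdd_le k.+1 (am x).
  have [N N0 bN] := multilin_bdd_le k.+1 (bm x).
  pose d := e / (2 ^+ k * (N + 1 + M + M) + 1).
  have c0 : 0 < 2 ^+ k * (N + 1 + M + M) + 1.
    by rewrite ltr_wpDl// mulr_ge0 ?exprn_ge0// !addr_ge0.
  have d0 : 0 < d by rewrite divr_gt0.
  have kp' := ltnW kp.
  have H1 := jet_diff_le aJ kp Xx d0; have H2 := jet_diff_le bJ kp Xx d0.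
  have H3 := jet_cont_le bJ kp' Xx d0; have H4 := jet_cont_le bJ kp' Xx ltr01.
  apply: filterS (filterI (filterI H1 H2) (filterI H3 H4)).
  move=> y [[{}H1 {}H2] [{}H3 {}H4]] s sk.
  set h := y - x in H1 H2 *.
  have -> : leibniz (alpha y) (beta y) s - leibniz (alpha x) (beta x) s -
      leibniz (alpha x) (beta x) (h :: s) =
    leibniz (fun s => alpha y s - alpha x s - alpha x (h :: s)) (beta y) s +
    leibniz (alpha x \o cons h) (fun s => beta y s - beta x s) s +
    leibniz (alpha x) (fun s => beta y s - beta x s - beta x (h :: s)) s.
    rewrite (leibnizBl (fun s => alpha y s - alpha x s) (alpha x \o cons h)).
    rewrite leibnizBl (leibnizBr _ (fun s => beta y s - beta x s) (beta x \o cons h)).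
    by rewrite !leibnizBr /=; exact: telescope3.
  have byN j : (j <= k)%N -> norm_le j (beta y) (N + 1).
    move=> jk t tj; rewrite -[beta y t](subrKC (beta x t)) mulrDl.
    apply: le_trans (ler_normD _ _) _; apply: lerD.
      by apply: bN tj; rewrite ?leqW.
    exact: (H4 j jk t tj).
  have axM j : (j <= k)%N -> norm_le j (alpha x \o cons h) (M * `|h|).
    by move=> jk t tj; rewrite -mulrA -nprod_cons; apply: (aM j.+1) => //=; rewrite tj.
  have dh0 : 0 <= d * `|h| by rewrite mulr_ge0// ltW.
  have T1 := leibniz_norm (M := d * `|h|) (N := N + 1) (a := fun s =>
    alpha y s - alpha x s - alpha x (h :: s)) (b := beta y) (s := s).
  have T2 := leibniz_norm (M := M * `|h|) (N := d) (a := alpha x \o cons h)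
    (b := fun s => beta y s - beta x s) (s := s).
  have T3 := leibniz_norm (M := M) (N := d * `|h|) (a := alpha x) (b := fun s =>
    beta y s - beta x s - beta x (h :: s)) (s := s).
  rewrite sk in T1 T2 T3.
  have {}T1 := T1 dh0 (addr_ge0 N0 ler01) H1 byN.
  have {}T2 := T2 (mulr_ge0 M0 (normr_ge0 h)) (ltW d0) axM H3.
  have {}T3 := T3 M0 dh0 (fun j jk => aM j (leqW jk)) H2.
  apply: le_trans (ler_normD _ _) _; apply: le_trans (lerD (ler_normD _ _) T3) _.
  apply: le_trans (lerD (lerD T1 T2) (lexx _)) _.
  rewrite -!mulrDl ler_wpM2r ?nprod_ge0//.
  have -> : 2 ^+ k * (d * `|h| * (N + 1)) + 2 ^+ k * (M * `|h| * d) +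
     2 ^+ k * (M * (d * `|h|)) = d * (2 ^+ k * (N + 1 + M + M)) * `|h| by ring.
  rewrite ler_wpM2r//; apply: le_trans (_ : d * (2 ^+ k * (N + 1 + M + M) + 1) <= e).
    by rewrite ler_wpM2l// ?(ltW d0)// lerDl.
  by rewrite /d divfK// gt_eqF.
- have [M M0 aM] := multilin_bdd_le k (am x).
  have [N N0 bN] := multilin_bdd_le k (bm x).
  pose d := e / (2 ^+ k * (N + 1 + M) + 1).
  have c0 : 0 < 2 ^+ k * (N + 1 + M) + 1.
    by rewrite ltr_wpDl// mulr_ge0 ?exprn_ge0// !addr_ge0.
  have d0 : 0 < d by rewrite divr_gt0.
  have H1 := jet_cont_le aJ kp Xx d0.
  have H3 := jet_cont_le bJ kp Xx d0; have H4 := jet_cont_le bJ kp Xx ltr01.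
  apply: filterS (filterI H1 (filterI H3 H4)) => y [{}H1 [{}H3 {}H4]] s sk.
  have byN j : (j <= k)%N -> norm_le j (beta y) (N + 1).
    move=> jk t tj; rewrite -[beta y t](subrKC (beta x t)) mulrDl.
    apply: le_trans (ler_normD _ _) _; apply: lerD.
      by apply: bN tj; rewrite ?leqW.
    exact: (H4 j jk t tj).
  have -> : leibniz (alpha y) (beta y) s - leibniz (alpha x) (beta x) s =
    leibniz (fun s => alpha y s - alpha x s) (beta y) s +
    leibniz (alpha x) (fun s => beta y s - beta x s) s.
    by rewrite leibnizBl leibnizBr addrA subrK.
  have T1 := leibniz_norm (M := d) (N := N + 1) (a := fun s =>
    alpha y s - alpha x s) (b := beta y) (s := s).
  have T2 := leibniz_norm (M := M) (N := d) (a := alpha x)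
    (b := fun s => beta y s - beta x s) (s := s).
  rewrite sk in T1 T2.
  have {}T1 := T1 (ltW d0) (addr_ge0 N0 ler01) H1 byN.
  have {}T2 := T2 M0 (ltW d0) aM H3.
  apply: le_trans (ler_normD _ _) _; apply: le_trans (lerD T1 T2) _.
  rewrite -mulrDl ler_wpM2r ?nprod_ge0//.
  have -> : 2 ^+ k * (d * (N + 1)) + 2 ^+ k * (M * d) =
     d * (2 ^+ k * (N + 1 + M)) by ring.
  apply: le_trans (_ : d * (2 ^+ k * (N + 1 + M) + 1) <= e).
    by rewrite ler_wpM2l// ?(ltW d0)// lerDl.
  by rewrite /d divfK// gt_eqF.
Qed.

End JetProduct.

(** * Multipliers *)

Section CpOfJet.
Context {R : realType} {G E : normedModType R}.
Variables (p : nat) (X : set G) (oX : open X).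

Lemma Cp_of_jet (alpha : G -> seq G -> E) : is_jet p X alpha ->
  exists g : Cp p X E, (forall x : X, g x = alpha (val x) [::]) /\
    forall k (x : X) M, (k <= p)%N -> 0 <= M -> norm_le k (alpha (val x)) M ->
      `|frechetD g k x| <= M.
Proof.
move=> aJ; exists (MkCp (asboolT (jet_is_Cp oX aJ))); split=> // k x M kp M0 aM.
by rewrite /= (frechetD_jet oX aJ kp); exact: norm_mlin_of.
Qed.

Lemma Cp_is_Cp (f : Cp p X E) : is_Cp p f.
Proof. by case: f => f /= /asboolP. Qed.

Lemma Cp_jet (f : Cp p X E) : is_jet p X (jet_of f).
Proof. exact/jet_of_is_jet/Cp_is_Cp. Qed.

Lemma norm_jet_of (f : Cp p X E) k (x : X) :
  norm_le k (jet_of f (val x)) `|frechetD f k x|.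
Proof.
have := @norm_list_of _ _ _ (fun k => 'valL_0 (frechetD f k) (val x)) k.
by rewrite valLE.
Qed.

Lemma Cp_mul_jet (alpha : G -> seq G -> R) (f : Cp p X E) : is_jet p X alpha ->
  exists g : Cp p X E, (forall x : X, g x = alpha (val x) [::] *: f x) /\
    forall k (x : X) M N, (k <= p)%N -> 0 <= M -> 0 <= N ->
      (forall j, (j <= p)%N -> norm_le j (alpha (val x)) M) ->
      (forall j, (j <= p)%N -> `|frechetD f j x| <= N) ->
      `|frechetD g k x| <= 2 ^+ p * (M * N).
Proof.
move=> aJ; have [g [gE gN]] := Cp_of_jet (jet_leibniz aJ (Cp_jet f)).
exists g; split=> [x|k x M N kp M0 N0 aM fN].
  by rewrite gE /= jet_of_nil.
apply: gN => //; first by rewrite !mulr_ge0.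
move=> s sk; apply: le_trans (leibniz_norm (M := M) (N := N) _ _ _ _) _ => //.
- by move=> j js; apply: aM; rewrite (leq_trans js)// sk.
- move=> j js t tj; apply: le_trans (norm_jet_of f x tj) _.
  by rewrite ler_wpM2r ?nprod_ge0// fN// (leq_trans js)// sk.
- rewrite ler_wpM2r ?nprod_ge0// ler_wpM2r ?mulr_ge0//.
  by rewrite ler_weXn2l// ?sk// ler1n.
Qed.

End CpOfJet.

Lemma near_comp (S T : topologicalType) (f : S -> T) (x : S) (P : set T) :
  continuous f -> (\forall t \near f x, P t) -> \forall y \near x, P (f y).
Proof. by move=> fc; exact: fc. Qed.

Section RidgeJet.
Context {R : realType} {G : normedModType R}.
Variables (p : nat) (q : nat -> R -> R) (l : {linear G -> R}) (L : R).
Hypothesis lL : forall v, `|l v| <= L * `|v|.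
Hypothesis qd : forall k, (k < p)%N -> forall t : R,
  is_derive t (1 : R) (q k) (q k.+1 t).
Hypothesis qc : forall k, (k <= p)%N -> continuous (q k).

Definition ridge_jet (x : G) (s : seq G) : R := q (size s) (l x) * \prod_(v <- s) l v.

Let L0 : 0 <= Num.max L 0. Proof. by rewrite le_max lexx orbT. Qed.
Let lM v : `|l v| <= Num.max L 0 * `|v|.
Proof. by apply: le_trans (lL v) _; rewrite ler_wpM2r// le_max lexx. Qed.

Lemma ridge_prod_le (s : seq G) :
  `|\prod_(v <- s) l v| <= Num.max L 0 ^+ size s * nprod s.
Proof.
elim: s => [|v s IHs]; first by rewrite /nprod !big_nil normr1 mulr1.
by rewrite nprod_cons big_cons normrM /= exprS mulrACA ler_pM.
Qed.

Let l_continuous : continuous l.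
Proof.
apply: bounded_linear_continuous; apply/linear_boundedP.
exists (Num.max L 0); split=> [|r Lr v]; first exact: num_real.
by apply: le_trans (lM v) _; rewrite ler_wpM2r// ltW.
Qed.

Lemma ridge_norm_le k x M : `|q k (l x)| * Num.max L 0 ^+ k <= M ->
  norm_le k (ridge_jet x) M.
Proof.
move=> qM s sk; rewrite /ridge_jet normrM.
apply: le_trans (ler_wpM2l (normr_ge0 _) (ridge_prod_le s)) _.
by rewrite mulrA ler_wpM2r ?nprod_ge0// sk.
Qed.

Lemma multilin_ridge x : multilin (ridge_jet x).
Proof.
split=> [s t st|c u v s|k].
- by rewrite /ridge_jet (perm_size st) (perm_big _ st).
- rewrite /ridge_jet /= !big_cons linearD linearZ /=.
  rewrite -[_ *: _]/(c * _) -[_ *: _]/(c * _).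
  by ring.
- exists (`|q k (l x)| * Num.max L 0 ^+ k); last exact: ridge_norm_le.
  by rewrite mulr_ge0// exprn_ge0.
Qed.

Lemma ridge_is_jet (X : set G) : is_jet p X ridge_jet.
Proof.
split=> [x|k x kp Xx e e0|k x kp Xx e e0]; first exact: multilin_ridge.
- pose c := Num.max L 0 ^+ k.+1 + 1.
  have c0 : 0 < c by rewrite ltr_wpDl// exprn_ge0.
  have [dq qE] := qd kp (l x).
  have dq' : differentiable (q k) (l x) by exact/derivable1_diffP.
  have ec : 0 < e / c by rewrite divr_gt0.
  have H := diff_near dq' ec.
  apply: filterS (near_comp l_continuous H) => y /= Hy s sk.
  rewrite /ridge_jet /= sk big_cons linearB /=.
  have -> : q k (l y) * \prod_(v <- s) l v - q k (l x) * \prod_(v <- s) l v -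
    q k.+1 (l x) * ((l y - l x) * \prod_(v <- s) l v) =
    (q k (l y) - q k (l x) - q k.+1 (l x) * (l y - l x)) * \prod_(v <- s) l v by ring.
  have dE : 'd (q k) (l x) (l y - l x) = q k.+1 (l x) * (l y - l x).
    rewrite -qE deriveE// -[l y - l x in LHS]mulr1.
    by rewrite -[_ * 1]/((l y - l x) *: (1 : R)) linearZ /= mulrC.
  rewrite dE in Hy; rewrite normrM.
  apply: le_trans (ler_pM _ _ Hy (ridge_prod_le s)) _ => //.
  rewrite sk mulrA ler_wpM2r ?nprod_ge0//.
  apply: le_trans (_ : e / c * (Num.max L 0 * `|y - x|) * Num.max L 0 ^+ k <= _).
    by rewrite ler_wpM2r ?exprn_ge0// ler_wpM2l ?(ltW ec)// -linearB.
  have -> : e / c * (Num.max L 0 * `|y - x|) * Num.max L 0 ^+ k =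
    e * (Num.max L 0 ^+ k.+1 / c) * `|y - x| by rewrite exprS; ring.
  rewrite ler_wpM2r// ler_piMr ?(ltW e0)// ler_pdivrMr// mul1r /c lerDl//.
- pose c := Num.max L 0 ^+ k + 1.
  have c0 : 0 < c by rewrite ltr_wpDl// exprn_ge0.
  have ec : 0 < e / c by rewrite divr_gt0.
  have /cvgrPdist_le/(_ _ ec) H : q k t @[t --> l x] --> q k (l x) by exact: qc.
  apply: filterS (near_comp l_continuous H) => y /= Hy s sk.
  rewrite /ridge_jet sk -mulrBl normrM distrC.
  apply: le_trans (ler_pM _ _ Hy (ridge_prod_le s)) _ => //.
  rewrite sk mulrA ler_wpM2r ?nprod_ge0// mulrAC ler_pdivrMr//.
  by rewrite ler_wpM2l ?(ltW e0)// lerDl.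
Qed.

End RidgeJet.

Section RescaledJet.
Context {R : realType} {G E : normedModType R}.

Lemma rescaled_jet p (alpha : G -> seq G -> E) (x0 : G) (c : R) (X : set G) :
  is_jet p [set: G] alpha ->
  is_jet p X (fun x s => c ^+ size s *: alpha (c *: (x - x0)) s).
Proof.
move=> aJ; pose y_ x : G := c *: (x - x0).
have yc : continuous y_.
  by move=> x; apply: cvgZl_tmp; apply: cvgB; [exact: cvg_id|exact: cvg_cst].
have am x := jet_multilin aJ x.
split=> [x|k x kp _ e e0|k x kp _ e e0].
- split=> [s t st|a u v s|k].
  + by rewrite (perm_size st) (multilin_perm (am _) st).
  + by rewrite (multilin_head (am _)) /= scalerDr !scalerA (mulrC a).
  + have [M M0 aM] := multilin_bdd (am (y_ x)) k.
    exists (`|c| ^+ k * M); first by rewrite mulr_ge0// exprn_ge0.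
    by move=> s sk; rewrite normrZ normrX sk -mulrA ler_wpM2l ?exprn_ge0// aM.
- pose d := `|c| ^+ k.+1 + 1.
  have d0 : 0 < d by rewrite ltr_wpDl// exprn_ge0.
  have ed : 0 < e / d by rewrite divr_gt0.
  have := near_comp yc (jet_diff aJ kp (I : [set: G] (y_ x)) ed).
  apply: filterS => y /= Hy s sk; rewrite sk.
  have -> : c ^+ k.+1 *: alpha (c *: (x - x0)) (y - x :: s) =
      c ^+ k *: alpha (y_ x) (y_ y - y_ x :: s).
    have -> : y_ y - y_ x = c *: (y - x).
      by rewrite /y_ -scalerBr opprB addrA subrK.
    by rewrite (multilin_headZ _ _ _ (am _)) scalerA exprSr.
  rewrite -[X in X - _]scalerBr -scalerBr normrZ normrX.
  apply: le_trans (ler_wpM2l _ (Hy s sk)) _; first by rewrite exprn_ge0.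
  have -> : y_ y - y_ x = c *: (y - x).
    by rewrite /y_ -scalerBr opprB addrA subrK.
  rewrite normrZ mulrA ler_wpM2r ?nprod_ge0//.
  have -> : `|c| ^+ k * (e / d * (`|c| * `|y - x|)) =
    e * (`|c| ^+ k.+1 / d) * `|y - x| by rewrite exprS; ring.
  by rewrite ler_wpM2r// ler_piMr ?(ltW e0)// ler_pdivrMr// mul1r /d lerDl.
- pose d := `|c| ^+ k + 1.
  have d0 : 0 < d by rewrite ltr_wpDl// exprn_ge0.
  have ed : 0 < e / d by rewrite divr_gt0.
  have := near_comp yc (jet_cont aJ kp (I : [set: G] (y_ x)) ed).
  apply: filterS => y /= Hy s sk; rewrite sk -scalerBr normrZ normrX.
  apply: le_trans (ler_wpM2l _ (Hy s sk)) _; first by rewrite exprn_ge0.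
  rewrite mulrA ler_wpM2r ?nprod_ge0// mulrCA ler_piMr ?(ltW e0)//.
  by rewrite ler_pdivrMr// mul1r lerDl.
Qed.

End RescaledJet.

(** * The topology of the space of functions of class C^p *)

Section CpLinear.
Context {R : realType} {G E : normedModType R} {p : nat} {X : set G}.
Implicit Types (f g : Cp p X E) (K : set X) (k : nat).

Lemma Cp_frechetD_lin (c : R) f g k x : (k <= p)%N ->
  frechetD (c *: f + g : Cp p X E) k x = c *: frechetD f k x + frechetD g k x.
Proof.
move=> kp.
have H := frechetD_lin c (Cp_is_Cp f) (Cp_is_Cp g) kp.
by rewrite -[LHS]/(frechetD (c *: (f : X -> E) + g) k x) H.
Qed.

Lemma Cp_frechetDD f g k x : (k <= p)%N ->
  frechetD (f + g : Cp p X E) k x = frechetD f k x + frechetD g k x.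
Proof. by move=> kp; rewrite -[f in LHS]scale1r Cp_frechetD_lin// scale1r. Qed.

Lemma Cp_frechetDZ (c : R) f k x : (k <= p)%N ->
  frechetD (c *: f : Cp p X E) k x = c *: frechetD f k x.
Proof.
move=> kp; rewrite -[c *: f in LHS]addr0 Cp_frechetD_lin//.
rewrite -[frechetD _ _ _ in X in _ + X]/(frechetD (0 : X -> E) k x) frechetD0.
by rewrite addr0.
Qed.

Lemma Cp_addE f g x : (f + g : Cp p X E) x = f x + g x. Proof. by []. Qed.
Lemma Cp_oppE f x : (- f : Cp p X E) x = - f x. Proof. by []. Qed.
Lemma Cp_scaleE (c : R) f x : (c *: f : Cp p X E) x = c *: f x. Proof. by []. Qed.
Lemma Cp_zeroE x : (0 : Cp p X E) x = 0. Proof. by []. Qed.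
Lemma Cp_eqP f g : (forall x, f x = g x) -> f = g.
Proof. by move=> fg; apply: val_inj; apply/funext. Qed.

Lemma norm_frechetD0 f x : `|frechetD f 0 x| = `|f x|.
Proof.
apply/eqP; rewrite eq_le; apply/andP; split; first by apply: op_norm_le.
have := @op_norm_ub _ _ _ _ (sym_mlin0 G (f x)) (fun=> 0); apply => i.
by rewrite normr0.
Qed.

Lemma Cp_bounded_compact f K : compact K ->
  exists2 M, 0 <= M & forall x, K x -> forall j, (j <= p)%N -> `|frechetD f j x| <= M.
Proof.
move=> cK.
suff H : forall k, (k <= p)%N -> exists2 M, 0 <= M &
    forall x, K x -> forall j, (j <= k)%N -> `|frechetD f j x| <= M by exact: (H p).
have B k : (k <= p)%N -> exists2 M, 0 <= M & forall x, K x -> `|frechetD f k x| <= M.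
  move=> kp; have fc := (Cp_is_Cp f).2 k kp.
  have /compact_bounded : compact (frechetD f k @` K).
    by apply: continuous_compact => //; exact: continuous_subspaceT.
  move=> /pinfty_ex_gt0[M M0 HM]; exists M; first exact: ltW.
  by move=> x Kx; apply: HM; exists x.
elim=> [|k IHk] kp.
  have [M M0 HM] := B 0 kp; exists M => // x Kx j; rewrite leqn0 => /eqP ->; exact: HM.
have [M M0 HM] := IHk (ltnW kp); have [N N0 HN] := B _ kp.
exists (M + N); first exact: addr_ge0.
move=> x Kx j; rewrite leq_eqVlt => /predU1P[->|jk].
  by rewrite (le_trans (HN x Kx))// lerDr.
by rewrite (le_trans (HM x Kx j jk))// lerDl.
Qed.

Lemma Cp_seminorm_le f K k M : 0 <= M ->
  (forall x, K x -> forall j, (j <= k)%N -> `|frechetD f j x| <= M) ->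
  Cp_seminorm K k f <= M.
Proof.
move=> M0 fM; rewrite /Cp_seminorm.
have [->|/set0P[x0 Kx0]] := eqVneq K set0; first by rewrite image_set0 sup0.
apply: ge_sup; first by eexists; exists x0.
move=> _ [x Kx <-]; apply: ge_sup; first by exists `|frechetD f 0 x|; exists 0.
by move=> _ [j /= jk <-]; exact: fM.
Qed.

Lemma Cp_seminorm_ge f K k x j : compact K -> (k <= p)%N -> K x -> (j <= k)%N ->
  `|frechetD f j x| <= Cp_seminorm K k f.
Proof.
move=> cK kp Kx jk; have [M M0 fM] := Cp_bounded_compact f cK.
have fM' y : K y -> forall i, (i <= k)%N -> `|frechetD f i y| <= M.
  by move=> Ky i ik; apply: fM => //; exact: leq_trans kp.
pose S y := [set `|frechetD f i y| | i in [set i | (i <= k)%N]].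
have supS y : K y -> has_sup (S y).
  move=> Ky; split; first by exists `|frechetD f 0 y|; exists 0.
  by exists M => _ [i /= ik <-]; exact: fM'.
apply: (le_trans (y := sup (S x))).
  by apply: (sup_upper_bound (supS x Kx)); exists j.
apply: (@sup_upper_bound _ [set sup (S y) | y in K]); last by exists x.
split; first by exists (sup (S x)); exists x.
exists M => _ [y Ky <-]; apply: ge_sup; first exact: (supS y Ky).1.
by move=> _ [i /= ik <-]; exact: fM'.
Qed.

(** The seminorms are directed, so that finitely many balls with arbitrary
    centres contain one of full order [p] centred at [f]; in other words, the
    sets [N] below form a filter, and the subbase around [f] lies in it. *)
Lemma Cp_nbhs_ball (U : set (Cp p X E)) f : open U -> U f ->
  exists K e, [/\ compact K, 0 < e & forall g,
    (forall x, K x -> forall j, (j <= p)%N -> `|frechetD g j x| <= e) -> U (f + g)].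
Proof.
move=> oU Uf.
pose small K e g := forall x, K x -> forall j, (j <= p)%N -> `|frechetD g j x| <= e.
pose N := [set A : set (Cp p X E) | exists K (e : R),
  [/\ compact K, 0 < e & forall g, small K e g -> A (f + g)]].
suff : N U by [].
have FN : Filter N.
  split.
  - by exists set0, 1; split=> //; exact: compact0.
  - move=> A B [K [e [cK e0 KA]]] [L [d [cL d0 LB]]].
    exists (K `|` L), (Num.min e d); split; first exact: compactU.
      by rewrite lt_min e0.
    move=> g sg; split; [apply: KA|apply: LB] => x Kx j jp.
      by rewrite (le_trans (sg x (or_introl Kx) j jp))// ge_min lexx.
    by rewrite (le_trans (sg x (or_intror Kx) j jp))// ge_min lexx orbT.
  - move=> A B AB [K [e [cK e0 KA]]]; exists K, e; split=> // g sg.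
    by apply: AB; exact: KA.
have basic B : Cp_subbase B -> B f -> N B.
  move=> [K [k [f0 [e [cK kp e0 ->]]]]] /= fe.
  have e2 : 0 < (e - Cp_seminorm K k (f - f0)) / 2 by rewrite divr_gt0// subr_gt0.
  exists K, ((e - Cp_seminorm K k (f - f0)) / 2).
  split; [exact: cK|exact: e2|move=> g sg].
  suff : Cp_seminorm K k (f + g - f0) < e by [].
  apply: (@le_lt_trans _ _ (Cp_seminorm K k (f - f0) +
      (e - Cp_seminorm K k (f - f0)) / 2)); last by lra.
  have s0 : 0 <= Cp_seminorm K k (f - f0).
    have [K0|/set0P[x0 Kx0]] := eqVneq K set0.
      by rewrite /Cp_seminorm K0 image_set0 sup0.
    by apply: le_trans (Cp_seminorm_ge (f - f0) cK kp Kx0 (leq0n k)).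
  apply: Cp_seminorm_le => [|x Kx j jk]; first by rewrite addr_ge0// ltW.
  have jp := leq_trans jk kp.
  rewrite addrAC Cp_frechetDD// (le_trans (ler_normD _ _))// lerD ?sg//.
  exact: Cp_seminorm_ge.
move: oU => [D sD UE]; move: Uf; rewrite -UE => -[A DA Af].
have [F sF FA] := sD _ DA.
have : N A.
  rewrite -FA; apply: filter_bigI => B BF; apply: basic; first exact/set_mem/sF.
  by move: Af; rewrite -FA; apply.
apply: filterS => g Ag; exists A => //.
Qed.

Lemma Cp_subbase_open (B : set (Cp p X E)) : Cp_subbase B -> open B.
Proof.
move=> sB; exists [set B]; last by rewrite bigcup_set1.
by move=> _ ->; exact: (@finI_from1 _ _ (@Cp_subbase R G p X E) id B sB).
Qed.

Lemma Cp_eval_linear (l : {linear E -> R}) (x : X) :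
  linear (fun f : Cp p X E => l (f x)).
Proof.
move=> c f g; rewrite Cp_addE Cp_scaleE linearP; exact: erefl.
Qed.

Lemma Cp_eval_continuous (l : {linear E -> R}) (x : X) :
  (forall v, `|l v| <= `|v|) -> continuous (fun f : Cp p X E => l (f x)).
Proof.
move=> l1 f; apply/(@cvgrPdist_lt _ _ _ (nbhs f) (nbhs_filter f)) => e e0.
have cx : compact [set x] by exact: compact_set1.
pose B := [set g : Cp p X E | Cp_seminorm [set x] 0 (g - f) < e].
have oB : open B by apply: Cp_subbase_open; exists [set x], 0%N, f, e; split.
have Bf : B f.
  apply: le_lt_trans (Cp_seminorm_le (M := 0) _ _) e0 => // y _ j.
  by rewrite leqn0 => /eqP ->; rewrite subrr norm_frechetD0 Cp_zeroE normr0.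
apply: filterS (open_nbhs_nbhs (conj oB Bf)) => g Bg.
rewrite -linearB (le_lt_trans (l1 _))//; apply: le_lt_trans Bg.
rewrite distrC -[g x - f x]/((g - f : Cp p X E) x) -norm_frechetD0.
exact: Cp_seminorm_ge.
Qed.

End CpLinear.

(** * Weak limits of images *)

Section WeakLimit.
Context {R : realType} {G H E F : normedModType R}.
Variables (p : nat) (X : set G) (Y : set H).

Definition Cp_eval (l : {linear F -> R}) (y : Y) (f : Cp p Y F) : R := l (f y).

Lemma Cp_eval_scalar l y : scalar (Cp_eval l y).
Proof. exact: Cp_eval_linear. Qed.

HB.instance Definition _ l y :=
  GRing.isLinear.Build R (Cp p Y F) R *%R (Cp_eval l y) (Cp_eval_scalar l y).

Lemma weak_eval_continuous (l : {linear F -> R}) (y : Y) :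
  (forall v, `|l v| <= `|v|) ->
  continuous (Cp_eval l y : weak_topology_on (Cp p Y F) -> R).
Proof.
move=> l1.
pose L : top_dual (Cp p Y F) :=
  exist _ (Cp_eval l y : {scalar Cp p Y F}) (Cp_eval_continuous (x := y) l1).
pose ev := (fun v l => sval l v) : Cp p Y F -> {ptws top_dual (Cp p Y F) -> R}.
move=> f; apply: (@continuous_comp _ _ _ (ev : weak_topology_on (Cp p Y F) -> _)
  (fun z => z L)).
  exact: initial_continuous.
exact: (@proj_continuous _ _ L).
Qed.

(** A weak cluster point of the images is an element of [Cp p Y F], hence smooth
    even where the sequence [f_] has no smooth limit. *)
Lemma weakly_compact_limit (T : {linear Cp p X E -> Cp p Y F}) :
  weakly_compact T ->
  exists2 K : set X, compact K & forall (f_ : nat -> Cp p X E) (M : R),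
    (forall n x, K x -> forall j, (j <= p)%N -> `|frechetD (f_ n) j x| <= M) ->
    exists u : Cp p Y F, forall (l : {linear F -> R}) (y : Y) (a : R),
      (forall v, `|l v| <= `|v|) ->
      (fun n => l (T (f_ n) y)) @ \oo --> a -> l (u y) = a.
Proof.
move=> [U [oU [g Ug] [C TUC [cC _]]]].
have [K [e [cK e0 KU]]] := Cp_nbhs_ball oU Ug.
exists K => // f_ M fM.
pose c := e / (`|M| + 1).
have M1 : 0 < `|M| + 1 by rewrite ltr_wpDl.
have c0 : 0 < c by rewrite divr_gt0.
pose z n : weak_topology_on (Cp p Y F) := T (g + c *: f_ n).
have zC : (z @ \oo) C.
  exists 0%N; first by [].
  move=> n _; apply: TUC; exists (g + c *: f_ n); last by [].
  apply: KU => x Kx j jp.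
  rewrite Cp_frechetDZ// normrZ gtr0_norm// /c mulrAC ler_pdivrMr//.
  rewrite ler_wpM2l ?(ltW e0)// (le_trans (fM n x Kx j jp))//.
  by rewrite (le_trans (ler_norm M))// lerDl.
have [w [_ wz]] := cC _ _ zC.
exists (c^-1 *: ((w : Cp p Y F) - T g)) => l y a l1 fa.
suff wE : l ((w : Cp p Y F) y) = l (T g y) + c * a.
  rewrite Cp_scaleE Cp_addE Cp_oppE linearZ linearB /= wE addrC addrA.
  by rewrite addNr add0r -[_ *: _]/(c^-1 * _) mulKf ?gt_eqF.
apply/eqP; rewrite -subr_eq0 -normr_le0; apply/ler_addgt0Pr => d d0.
rewrite add0r; have d2 : 0 < d / 2 by rewrite divr_gt0.
have za : (fun n => l ((z n : Cp p Y F) y)) @ \oo --> l (T g y) + c * a.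
  have -> : (fun n => l ((z n : Cp p Y F) y)) =
      (fun n => l (T g y) + c * l (T (f_ n) y)).
    apply/funext => n; rewrite /z linearD linearZ Cp_addE Cp_scaleE.
    by rewrite linearD linearZ.
  by apply: cvgD; [exact: cvg_cst|exact: cvgMl_tmp].
have A : (z @ \oo) [set v | `|l (T g y) + c * a - l ((v : Cp p Y F) y)| <= d / 2].
  by move/cvgrPdist_le : za => /(_ _ d2).
have /cvgrPdist_le/(_ _ d2) B := weak_eval_continuous (y := y) l1 (x := w).
have [v [vA vB]] := wz _ _ A B.
rewrite [leLHS](_ : _ = `|(l ((w : Cp p Y F) y) - l ((v : Cp p Y F) y)) +
    - (l (T g y) + c * a - l ((v : Cp p Y F) y))|); last by congr (`|_|); ring.
apply: le_trans (ler_normD _ _) _; rewrite normrN [leRHS]splitr lerD//.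
Qed.

End WeakLimit.

(** * Existence of the support point *)

Section Vanishing.
Context {R : realType} {G E : normedModType R} {p : nat} {X : set G}.
Hypothesis oX : open X.

Lemma frechetD_vanish (f : X -> E) (x : X) : (\forall z \near x, f z = 0) ->
  forall k, \forall z \near x, frechetD f k z = 0.
Proof.
move=> fx; elim=> [|k IHk].
  by apply: filterS fx => z /= ->; apply: val_inj; apply/funext.
have H : \forall y \near val x, 'valL_0 (frechetD f k) y = 0.
  by apply/near_val => //; apply: filterS IHk => z; exact: (etrans (valLE _ _)).
have {}H := near_join H.
have {}H : \forall z \near x, \forall y \near val z, 'valL_0 (frechetD f k) y = 0.
  exact: (near_val oX x _).1 H.
apply: filterS H => z H.
have [_ dE] : differentiable ('valL_0 (frechetD f k)) (val z) /\
    'd ('valL_0 (frechetD f k)) (val z) = \0 :> (G -> sym_mlin k G E).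
  apply: diff_nearP => [|e e0]; first exact: cst_continuous.
  apply: filterS (H) => y ->; rewrite (nbhs_singleton H) !subr0 normr0.
  by rewrite mulr_ge0// ltW.
by apply: fderivE => v w; rewrite dE.
Qed.

Lemma near_radius (f : X -> E) (x : X) : (\forall z \near x, f z = 0) <->
  exists2 r : R, 0 < r & forall z : X, `|val z - val x| < r -> f z = 0.
Proof.
split=> [H|[r r0 fr]].
  have : \forall y \near val x, 'valL_0 f y = 0.
    by apply/near_val => //; apply: filterS H => z; exact: (etrans (valLE _ _)).
  move=> /nbhs_normP[r r0 rf]; exists r => // z zr.
  by rewrite -[f z]valLE; apply: rf; rewrite /= distrC.
have : \forall y \near val x, `|y - val x| < r.
  by apply/nbhs_normP; exists r => //= y /=; rewrite distrC.
move/(near_val oX x (fun y => `|y - val x| < r)).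
by apply: filterS => z; exact: fr.
Qed.

Lemma Cp_near (f : Cp p X E) (x : X) (e : R) : 0 < e ->
  exists2 d : R, 0 < d & forall z : X, `|val z - val x| < d -> `|f z - f x| <= e.
Proof.
move=> e0; have := jet_cont (Cp_jet oX f) (leq0n p) (set_valP x) e0.
move=> /nbhs_normP[d /= d0 df]; exists d => // z zd.
have := df (val z); rewrite /= distrC => /(_ zd) H.
have := H [::] erefl.
by rewrite -[val]/(\val) !jet_of_nil /nprod big_nil mulr1.
Qed.

End Vanishing.

Section BumpMul.
Context {R : realType} {G E : normedModType R} {p : nat} {X : set G}.
Hypothesis oX : open X.

Lemma bump_mul (x0 : X) (r : R) (f : Cp p X E) : has_bump p G -> 0 < r ->
  exists g : Cp p X E, [/\
    forall x : X, `|val x - val x0| < r / 2 -> g x = f x,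
    forall x : X, r <= `|val x - val x0| -> g x = 0 &
    forall x : X, f x = 0 -> g x = 0].
Proof.
move=> [phi [phi1 phi0 _]] r0.
have J := rescaled_jet (val x0) r^-1 X (Cp_jet (@openT G) phi).
have [g [gE _]] := Cp_mul_jet oX f J.
pose w (x : X) : [set: G] := exist _ (r^-1 *: (val x - val x0)) (mem_set I).
have {}gE x : g x = phi (w x) *: f x.
  by rewrite gE /= expr0 scale1r -(jet_of_nil phi (w x)).
have wN x : `|val (w x)| = `|val x - val x0| / r.
  by rewrite /= normrZ gtr0_norm ?invr_gt0// mulrC.
exists g; split=> x H; rewrite gE.
- by rewrite phi1 ?scale1r// wN ler_pdivrMr// mulrC ltW.
- by rewrite phi0 ?scale0r// wN ler_pdivlMr// mul1r.
- by rewrite H scaler0.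
Qed.

End BumpMul.

Section SupportPoint.
Context {R : realType} {G H E F : normedModType R} {p : nat}.
Variables (X : set G) (Y : set H) (T : {linear Cp p X E -> Cp p Y F}).
Hypotheses (oX : open X) (oY : open Y) (bump : has_bump p G).
Hypotheses (wT : weakly_compact T) (sT : separating T) (nT : nowhere_trivial T).

(** If the derivatives of [f] vanish on [K], then all multiples of [f] stay in a
    given neighbourhood, so that their images are weakly bounded. *)
Lemma weakly_compact_vanish : exists2 K : set X, compact K & forall f : Cp p X E,
  (forall x, K x -> forall j, (j <= p)%N -> frechetD f j x = 0) -> T f = 0.
Proof.
have [U [oU [g Ug] [C TUC [cC _]]]] := wT.
have [K [e [cK e0 KU]]] := Cp_nbhs_ball oU Ug.
exists K => // f f0; apply: Cp_eqP => y; rewrite Cp_zeroE.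
have [l [lf l1]] := hahn_banach_norming (T f y).
have : compact (Cp_eval l y @` C).
  apply: (@continuous_compact (weak_topology_on (Cp p Y F))) => //.
  by apply: continuous_subspaceT; exact: weak_eval_continuous.
move=> /compact_bounded/pinfty_ex_gt0[M M0 HM].
apply/eqP; rewrite -normr_le0; apply/ler_addgt0Pr => d d0; rewrite add0r.
pose c := (M + `|l (T g y)|) / d.
have c0 : 0 < c by rewrite divr_gt0// ltr_pwDl.
have : `|l (T (g + c *: f) y)| <= M.
  apply: HM; exists (T (g + c *: f)) => //; apply: TUC; exists (g + c *: f) => //.
  apply: KU => x Kx j jp; rewrite Cp_frechetDZ// f0// scaler0 normr0; exact: ltW.
rewrite linearD linearZ Cp_addE Cp_scaleE linearD linearZ /= -[_ *: _]/(c * _).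
rewrite lf => Hc.
rewrite -(ler_pM2l c0) [leRHS](_ : _ = M + `|l (T g y)|); last first.
  by rewrite /c divfK// gt_eqF.
apply: le_trans (lerD Hc (lexx _)).
rewrite -[leLHS](addKr (l (T g y))) addrC; apply: le_trans (ler_norm _) _.
exact: ler_normB.
Qed.

(** [T f y] depends on [f] near a single point: by a finite cover of the compact
    set carrying [T], otherwise multiplications by bumps would kill [T f y] for
    every [f]. *)
Lemma exists_support_point (y : Y) : exists x0 : X, forall r : R, 0 < r ->
  exists2 f : Cp p X E, T f y != 0 &
    forall x : X, r <= `|val x - val x0| -> f x = 0.
Proof.
have [K cK KT] := weakly_compact_vanish.
apply: contrapT => nx.
have /choice[r_ r_P] : forall x0 : X, exists r : R, 0 < r /\
    forall f : Cp p X E, (forall x : X, r <= `|val x - val x0| -> f x = 0) -> T f y = 0.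
  move=> x0; apply: contrapT => nr; apply: nx; exists x0 => r r0.
  apply: contrapT => nf; apply: nr; exists r; split=> // f f0.
  by apply/eqP/negPn/negP => Tf; apply: nf; exists f.
pose B (x0 : X) : set X := [set x | `|val x - val x0| < r_ x0 / 2].
have oB x0 : setT x0 -> open (B x0).
  move=> _; exists (ball (val x0) (r_ x0 / 2)); first exact: ball_open.
  by apply/seteqP; split=> x; rewrite -ball_normE /B /= distrC.
(* a finite subcover, from the filter of the lists containing a given list *)
have [D KD] : exists D : seq X, forall x, K x -> exists2 i, i \in D & B i x.
  pose Q := [set A : set (seq X) |
    exists s0 : seq X, forall s : seq X, {subset s0 <= s} -> A s].
  have FQ : Filter Q.
    split; first by exists [::].
    - move=> A A' [s sA] [t tA]; exists (s ++ t) => u su; split.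
        by apply: sA => v vs; apply: su; rewrite mem_cat vs.
      by apply: tA => v vt; apply: su; rewrite mem_cat vt orbT.
    - by move=> A A' AA [s sA]; exists s => u /sA/AA.
  have /compact_near_coveringP KP := cK.
  have [s sK] : Q [set s : seq X | K `<=` [set x | exists2 i, i \in s & B i x]].
    apply: (KP _ Q (fun s x => exists2 i, i \in s & B i x) FQ) => x _.
    exists (B x, [set s : seq X | x \in s]); last first.
      by move=> [z s] /= [Bz xs]; exists x.
    split=> /=; last by exists [:: x] => s; apply; rewrite mem_head.
    apply: open_nbhs_nbhs; split; first exact: oB.
    by rewrite /B /= subrr normr0 divr_gt0// (r_P x).1.
  by exists s => x; exact: (sK s).
suff Hs (s : seq X) (f : Cp p X E) : (forall x, K x ->
    (exists2 i, i \in s & B i x) \/ \forall z \near x, f z = 0) -> T f y = 0.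
  by have [f /eqP] := nT y; apply; apply: (Hs D) => x /KD xD; left.
elim: s f => [|i s IHs] f fP.
  rewrite KT ?Cp_zeroE// => x Kx j _.
  have [[]//|fx] := fP x Kx.
  exact: (nbhs_singleton (frechetD_vanish oX fx j)).
have [ri fi] := r_P i.
have [g [g1 g0 gf]] := bump_mul oX i f bump ri.
have Tg : T g y = 0 by apply: fi => x; exact: g0.
rewrite -[f](subrK g) linearD Cp_addE Tg addr0; apply: IHs => x Kx.
have near0 : (\forall z \near x, f z = 0) ->
    \forall z \near x, (f - g : Cp p X E) z = 0.
  by apply: filterS => z fz; rewrite Cp_addE Cp_oppE fz gf// subrr.
have [[j]|fx] := fP x Kx; last by right; exact: near0.
rewrite inE => /predU1P[->|js] Bj; last by left; exists j.
right; have : nbhs x (B i) by apply: open_nbhs_nbhs; split => //; exact: oB.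
by apply: filterS => z Bz; rewrite Cp_addE Cp_oppE g1// subrr.
Qed.

Definition supports (h : Y -> X) := forall (y : Y) (r : R), 0 < r ->
  exists2 f : Cp p X E, T f y != 0 &
    forall x : X, r <= `|val x - val (h y)| -> f x = 0.

Lemma exists_supports : exists h, supports h.
Proof.
by have [h hP] := choice exists_support_point; exists h.
Qed.

Variables (h : Y -> X) (hP : supports h).

Lemma supports_local (f : Cp p X E) (y : Y) (r : R) : 0 < r ->
  (forall x : X, `|val x - val (h y)| < r -> f x = 0) -> T f y = 0.
Proof.
move=> r0 f0; have [g Tg g0] := hP y r0.
have : disjoint_fun f g.
  by move=> x; have [xr|xr] := ltP `|val x - val (h y)| r; [left|right]; auto.
by move=> /sT/(_ y)[//|/eqP]; rewrite (negPf Tg).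
Qed.

Lemma supports_continuous (y : Y) (r : R) : 0 < r ->
  exists2 d : R, 0 < d & forall z : Y, `|val z - val y| < d ->
    `|val (h z) - val (h y)| < r.
Proof.
move=> r0; have r2 : 0 < r / 2 by rewrite divr_gt0.
have [f Tf f0] := hP y r2.
have e0 : 0 < `|T f y| / 2 by rewrite divr_gt0// normr_gt0.
have [d d0 dP] := Cp_near oY (T f) y e0.
exists d => // z /dP zd; rewrite ltNge; apply/negP => hr.
move: Tf; rewrite -normr_gt0 ltNge => /negP; apply.
have Tz : T f z = 0.
  apply: (supports_local r2) => x xr; apply: f0.
  have := ler_normD (val (h z) - val x) (val x - val (h y)).
  by rewrite addrA subrK (distrC (val (h z)) (val x)); lra.
by move: zd; rewrite Tz sub0r normrN; lra.
Qed.

End SupportPoint.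

(** * The support map *)

Section OnePoint.
Context {X : topologicalType}.

Lemma one_point_closed_some (K : set X) : compact K -> closed K ->
  closed (Some @` K : set (one_point_compactification X)).
Proof.
move=> cK clK; rewrite -openC openE => -[b|] nK.
  have nKb : nbhs b (~` K).
    apply: open_nbhs_nbhs; split; first exact: closed_openC.
    by move=> Kb; apply: nK; exists b.
  have := one_point_compactification_some_nbhs _ _ nKb.
  apply: (@filterS _ _ (@nbhs_filter (one_point_compactification X) (Some b))).
  by move=> _ [c nKc <-] [d Kd [dc]]; apply: nKc; rewrite -dc.
exists K; first by split.
by move=> _ [[c nKc <-] [d Kd [dc]]|-> [d _ //]]; apply: nKc; rewrite -dc.
Qed.

End OnePoint.

Section SupportMapPoint.
Context {R : realType} {G : normedModType R} {p : nat} {X : set G}.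
Hypothesis oX : open X.

Lemma AX_coord_continuous (psi : Cp p X R) :
  continuous (fun w : @AX R G p X => val w psi : one_point_compactification R).
Proof.
move=> w.
apply: (@continuous_comp _ _ _ (set_val : @AX R G p X -> _)
  (fun z : {ptws Cp p X R -> one_point_compactification R} => z psi)).
  exact: initial_continuous.
exact: (@proj_continuous _ _ psi).
Qed.

Lemma Cp_continuous (E : normedModType R) (f : Cp p X E) : continuous f.
Proof.
move=> x; apply/(@cvgrPdist_le _ _ _ (nbhs x) (nbhs_filter x)) => e e0.
have [d d0 dP] := Cp_near oX f x e0.
have : \forall y \near val x, `|y - val x| < d.
  by apply/nbhs_normP; exists d => //= y /=; rewrite distrC.
move/(near_val oX x (fun y => `|y - val x| < d)).
by apply: filterS => z /dP; rewrite distrC.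
Qed.

Lemma AX_incl_continuous : continuous (@AX_incl R G p X).
Proof.
move=> x.
have H : @AX_embed R G p X @ x --> @AX_embed R G p X x.
  have FF : Filter (@AX_embed R G p X @ x).
    by exact: (@fmap_filter _ _ _ _ (nbhs_filter x)).
  apply/cvg_sup => psi; apply/(cvg_image _ FF).
    by apply/seteqP; split=> // v _; exists (fun=> v).
  move=> W Wx; exists (@^~ psi @^-1` W).
    exact: (Cp_continuous Wx).
  by apply/seteqP; split=> [_ [v Wv <-]//|v Wv]; exists (fun=> v).
move=> B [_ [[V oV <-] Vx VB]].
have : nbhs (@AX_embed R G p X x) V by apply: open_nbhs_nbhs; split.
move=> /H; apply: (@filterS _ _ (nbhs_filter x)) => z Vz; exact: VB.
Qed.

Lemma AX_incl_separated (x : X) (z : @AX R G p X) : z <> @AX_incl R G p X x ->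
  exists (psi : Cp p X R) (e : R), 0 < e /\
    forall t, `|t - psi x| <= e -> val z psi <> Some t.
Proof.
move=> zx.
have [psi zpsi] : exists psi, val z psi <> Some (psi x).
  apply: contrapT => nz; apply: zx; apply: val_inj; apply/funext => psi.
  by apply: contrapT => H; apply: nz; exists psi.
exists psi; case E : (val z psi) zpsi => [b|] zb; last by exists 1.
have bx : b != psi x by apply/eqP => bx; apply: zb; rewrite bx.
exists (`|b - psi x| / 2); split.
  by rewrite divr_gt0// normr_gt0 subr_eq0.
move=> t te [bt]; move: te; rewrite -bt.
have : 0 < `|b - psi x| by rewrite normr_gt0 subr_eq0.
by lra.
Qed.

End SupportMapPoint.

Section SupportMap.
Context {R : realType} {G H E F : normedModType R} {p : nat}.
Variables (X : set G) (Y : set H) (T : {linear Cp p X E -> Cp p Y F}).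
Hypotheses (oX : open X) (sT : separating T).
Variables (h : Y -> X) (hP : supports T h).

(** A point [z] other than [h y] differs from it in some coordinate [psi]; the
    functions supported close to [h y] have their closed carriers in the preimage
    by [psi] of a small interval around [psi (h y)], which avoids [z]. *)
Lemma supports_is_support_map : is_support_map T h.
Proof.
move=> y; apply/seteqP; split=> [z zU|_ -> U [oU [f Tf fU]]]; last first.
  apply: subset_closure; apply: fU => B Bh.
  have := AX_incl_continuous oX Bh => /= BX.
  apply: contrapT => nB.
  have f0 : \forall x \near h y, f x = 0.
    move: BX; apply: (@filterS _ _ (nbhs_filter (h y))) => x Bx.
    apply: contrapT => /eqP fx; apply: nB.
    by exists (AX_incl p x); split=> //; exists x.
  have [r r0 fr] := (near_radius oX f (h y)).1 f0.
  by move: Tf; rewrite (supports_local sT hP r0 fr) eqxx.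
apply: contrapT => /AX_incl_separated[psi [e [e0 ze]]].
pose C (d : R) : set (@AX R G p X) :=
  [set w | exists2 t, `|t - psi (h y)| <= d & val w psi = Some t].
have clC d : 0 < d -> closed (C d).
  move=> d0.
  have -> : C d =
      (fun w : @AX R G p X => val w psi : one_point_compactification R) @^-1`
      (Some @` [set t | `|t - psi (h y)| <= d]).
    by apply/seteqP; split=> w [t td wt]; exists t.
  apply: closed_comp; first by move=> w _; exact: AX_coord_continuous.
  have -> : [set t | `|t - psi (h y)| <= d] = [set` `[psi (h y) - d, psi (h y) + d]].
    by apply/seteqP; split=> t /=; rewrite in_itv /= ler_distl.
  by apply: one_point_closed_some; [exact: segment_compact|exact: interval_closed].
have e2 : 0 < e / 2 by rewrite divr_gt0.
pose U : set (@AX R G p X) :=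
  [set w | exists2 t, `|t - psi (h y)| < e & val w psi = Some t].
have oU : open U.
  have -> : U =
      (fun w : @AX R G p X => val w psi : one_point_compactification R) @^-1`
      (Some @` [set t | `|t - psi (h y)| < e]).
    by apply/seteqP; split=> w [t td wt]; exists t.
  apply: open_comp; first by move=> w _; exact: AX_coord_continuous.
  apply: one_point_compactification_open_some.
  have -> : [set t | `|t - psi (h y)| < e] = ball (psi (h y)) e.
    by apply/seteqP; split=> t; rewrite -ball_normE /= distrC.
  exact: ball_open.
have [r r0 rP] := Cp_near oX psi (h y) e2.
have [f Tf f0] := hP y r0.
have [t te zt] : C e z.
  have : closure U z.
    apply: zU; split=> //; exists f => //.
    apply: (@subset_trans _ (C (e / 2))).
      rewrite [X in _ `<=` X](closure_id _).1; last exact: clC.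
      apply: closure_subset => _ [x fx <-]; exists (psi x) => //.
      by apply: rP; rewrite ltNge; apply/negP => /f0 /eqP; apply/negP.
    by move=> w [t te wt]; exists t => //; apply: le_lt_trans te _; lra.
  rewrite [C e](closure_id _).1; last exact: clC.
  by apply: closure_subset => w [t te wt]; exists t => //; exact: ltW.
exact: (ze t te zt).
Qed.

End SupportMap.

(** * Averaged kinks *)

Section Ramp.
Context {R : realType}.
Implicit Types (t a d : R) (k n p : nat).

Lemma is_derive_near (f : R -> R) (x D : R) :
  (forall e, 0 < e -> \forall y \near x, `|f y - f x - D * (y - x)| <= e * `|y - x|) ->
  is_derive x (1 : R) f D.
Proof.
move=> fD.
have dl : linear (fun y : R => D * y).
  by move=> c u v; rewrite mulrDr -[c *: u]/(c * u) mulrCA.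
pose L := GRing.isLinear.Build _ _ _ _ _ dl.
pose df : {linear R -> R} := HB.pack (fun y : R => D * y) L.
have [dfx dE] : differentiable f x /\ 'd f x = df :> (R -> R).
  apply: diff_nearP => [y|]; last exact: fD.
  by apply: (@cvgMl_tmp _ _ (nbhs y) _ id D y); exact: cvg_id.
split; first exact/derivable1_diffP.
by rewrite deriveE// dE -[df 1]/(D * 1) mulr1.
Qed.

Lemma is_derive_mull (f : R -> R) (c x D : R) :
  is_derive x (1 : R) f D -> is_derive x (1 : R) (fun y => c * f y) (c * D).
Proof. by move=> fD; have := @is_deriveZ R R R f c x 1 D fD. Qed.

Lemma is_derive_sub (f g : R -> R) (x D D' : R) : is_derive x (1 : R) f D ->
  is_derive x (1 : R) g D' -> is_derive x (1 : R) (fun y => f y - g y) (D - D').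
Proof. by move=> fD gD; exact: is_deriveB. Qed.

Definition pospart t : R := Num.max t 0.

Lemma is_derive_pospart2 t :
  is_derive t (1 : R) (fun x => pospart x ^+ 2) (2 * pospart t).
Proof.
apply: is_derive_near => e e0.
have : \forall y \near t, `|y - t| <= e.
  by apply/nbhs_normP; exists e => //= y /=; rewrite distrC => /ltW.
apply: filterS => y ye.
apply: (@le_trans _ _ (`|y - t| * `|y - t|)); last by rewrite ler_wpM2r.
rewrite -normrM -expr2 ger0_norm ?sqr_ge0// /pospart ler_norml.
have yt := sqr_ge0 (y - t); have y2 := sqr_ge0 y; have t2 := sqr_ge0 t.
have [t0|t0] := leP t 0; have [y0|y0] := leP y 0; rewrite !expr2 in yt y2 t2 *.
- by apply/andP; split; lra.
- by have := mulr_le0_ge0 t0 (ltW y0) => ty; apply/andP; split; lra.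
- by have := mulr_ge0_le0 (ltW t0) y0 => ty; apply/andP; split; lra.
- by apply/andP; split; lra.
Qed.

Lemma is_derive_pospart n t :
  is_derive t (1 : R) (fun x => pospart x ^+ n.+2) (n.+2%:R * pospart t ^+ n.+1).
Proof.
elim: n => [|n IHn]; first exact: is_derive_pospart2.
have -> : (fun x => pospart x ^+ n.+3) =
    (fun x : R => x) * (fun x => pospart x ^+ n.+2).
  apply/funext => x; rewrite fctE /pospart.
  rewrite -[RHS]/(x * Num.max x 0 ^+ n.+2).
  by have [x0|x0] := leP x 0; rewrite -?exprS// !expr0n mulr0.
apply: is_derive_eq; rewrite -[_ *: _ in X in X + _]/(_ * _) -[_ *: 1]/(_ * 1).
rewrite mulr1 [n.+3%:R]mulrSr [RHS]mulrDl mul1r; congr (_ + _).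
rewrite mulrCA /pospart; congr (_ * _).
by have [t0|t0] := leP t 0; rewrite ?expr0n /= ?mulr0 ?[RHS]exprS.
Qed.

Lemma pospart_continuous : continuous pospart.
Proof.
move=> t; apply/cvgrPdist_le => e e0.
have : \forall y \near t, `|t - y| <= e.
  by apply/nbhs_normP; exists e => //= y /= /ltW.
apply: filterS => y; apply: le_trans.
rewrite /pospart; have [t0|t0] := leP t 0; have [y0|y0] := leP y 0.
- by rewrite subrr normr0.
- by rewrite sub0r normrN (gtr0_norm y0) distrC ler_normr; apply/orP; left; lra.
- by rewrite subr0 (gtr0_norm t0) ler_normr; apply/orP; left; lra.
- by [].
Qed.

Definition trunc_pow p k t := (p.+1 ^_ k)%:R * pospart t ^+ (p.+1 - k).

Lemma is_derive_trunc_pow p k t : (k < p)%N ->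
  is_derive t (1 : R) (trunc_pow p k) (trunc_pow p k.+1 t).
Proof.
move=> kp; have [n pE] : exists n, p = (k.+1 + n)%N.
  by exists (p - k.+1)%N; rewrite subnKC.
have E1 : (p.+1 - k = n.+2)%N by rewrite pE; lia.
have E2 : (p.+1 - k.+1 = n.+1)%N by rewrite pE; lia.
rewrite /trunc_pow E1 E2 ffactnSr E1 natrM -mulrA.
exact: (is_derive_mull _ (is_derive_pospart n t)).
Qed.

Lemma trunc_pow_continuous p k : continuous (trunc_pow p k).
Proof.
move=> t; rewrite /trunc_pow; apply: cvgMl_tmp.
apply: (@continuous_comp _ _ _ pospart (fun x => x ^+ (p.+1 - k))).
  exact: pospart_continuous.
exact: exprn_continuous.
Qed.

(** Averages of the kinks [(t - b)_+ ^ p] over [b] between [a + d] and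
    [a + 2 d], and their derivatives. They vanish near the half-line [t <= a],
    tend to the kink at [a], and have bounded derivatives up to order [p]. *)
Definition ramp p a d k t :=
  (p.+1%:R * d)^-1 * (trunc_pow p k (t - (a + d)) - trunc_pow p k (t - (a + 2 * d))).

Lemma is_derive_ramp p a d k t : (k < p)%N ->
  is_derive t (1 : R) (ramp p a d k) (ramp p a d k.+1 t).
Proof.
move=> kp.
have H b : is_derive t (1 : R) (fun x => trunc_pow p k (x - b))
    (trunc_pow p k.+1 (t - b)).
  have H1 := is_derive_trunc_pow (t - b) kp.
  have H2 : is_derive t (1 : R) (fun x : R => x - b) 1.
    by apply: is_derive_eq; rewrite subr0.
  have := @is_derive1_comp _ (trunc_pow p k) (fun x => x - b) t _ _ H1 H2.
  by rewrite mulr1.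
exact: (is_derive_mull _ (is_derive_sub (H (a + d)) (H (a + 2 * d)))).
Qed.

Lemma ramp_continuous p a d k : continuous (ramp p a d k).
Proof.
move=> t; rewrite /ramp; apply: cvgMl_tmp.
have H b : (trunc_pow p k (x - b)) @[x --> t] --> trunc_pow p k (t - b).
  apply: (@continuous_comp _ _ _ (fun x : R => x - b)).
    by apply: cvgB; [exact: cvg_id|exact: cvg_cst].
  exact: trunc_pow_continuous.
by apply: cvgB; exact: H.
Qed.

Lemma ramp_eq0 p a d t : 0 < d -> t <= a + d -> ramp p a d 0 t = 0.
Proof.
move=> d0 td; rewrite /ramp /trunc_pow /pospart subn0.
have -> : Num.max (t - (a + d)) 0 = 0 by apply/max_idPr; lra.
have -> : Num.max (t - (a + 2 * d)) 0 = 0 by apply/max_idPr; lra.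
by rewrite subrr mulr0.
Qed.

Definition ramp_coef p k : R :=
  'C(p.+1, k.+1)%:R * (-1) ^+ k.+1 * (1 - 2 ^+ k.+1) / p.+1%:R.

Lemma ramp_coef0 p : ramp_coef p 0 = 1.
Proof.
have pn0 : p.+1%:R != 0 :> R by rewrite pnatr_eq0.
rewrite /ramp_coef bin1 !expr1.
have -> : p.+1%:R * -1 * (1 - 2) = p.+1%:R :> R by ring.
exact: divff.
Qed.

Lemma ramp_poly p a d t : 0 < d -> a + 2 * d <= t ->
  ramp p a d 0 t =
  \sum_(i < p.+1) ramp_coef p i * d ^+ i * (t - a) ^+ (p - i).
Proof.
move=> d0 td; rewrite /ramp /trunc_pow /pospart subn0 ffactn0 !mul1r.
rewrite (max_idPl _); last by lra.
rewrite (max_idPl _); last by lra.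
have -> : t - (a + d) = (t - a) + - d by ring.
have -> : t - (a + 2 * d) = (t - a) + - (2 * d) by ring.
rewrite !exprDn -sumrB big_ord_recl !expr0 subrr add0r mulr_sumr.
apply: eq_bigr => i _; rewrite lift0 subSS /ramp_coef.
rewrite -mulrnBl -mulrBr -mulr_natr.
have -> : (- d) ^+ i.+1 - (- (2 * d)) ^+ i.+1 =
    (-1) ^+ i.+1 * (1 - 2 ^+ i.+1) * d ^+ i * d.
  by rewrite (exprNn d) (exprNn (2 * d)) exprMn !exprS; ring.
have pn0 : p.+1%:R != 0 :> R by rewrite pnatr_eq0.
have dn0 : d != 0 by rewrite gt_eqF.
move: pn0; generalize (p.+1%:R : R) => q qn0.
by field; rewrite qn0 dn0.
Qed.

Lemma exp_lipschitz n (x y D : R) : `|x| <= D -> `|y| <= D ->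
  `|x ^+ n - y ^+ n| <= n%:R * D ^+ n.-1 * `|x - y|.
Proof.
move=> xD yD; rewrite subrXX normrM mulrC ler_wpM2r//.
have D0 : 0 <= D by rewrite (le_trans _ xD).
apply: le_trans (ler_norm_sum _ _ _) _.
apply: (@le_trans _ _ (\sum_(i < n) D ^+ n.-1)); last first.
  by rewrite sumr_const card_ord mulr_natl.
apply: ler_sum => i _; rewrite normrM !normrX.
have -> : D ^+ n.-1 = D ^+ (n.-1 - i) * D ^+ i.
  by rewrite -exprD subnK//; case: n i => [[]//|n] i; rewrite -ltnS ltn_ord.
by rewrite ler_pM ?exprn_ge0// lerXn2r// ?nnegrE.
Qed.

Lemma ramp_bounded p a (B : R) : exists2 C, 0 <= C & forall d k t,
  0 < d <= 1 -> (k <= p)%N -> `|t| <= B -> `|ramp p a d k t| <= C.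
Proof.
pose D := `|B| + `|a| + 2.
pose c k : R := (p.+1 ^_ k)%:R * ((p.+1 - k)%:R * D ^+ (p.+1 - k).-1).
have D0 : 0 <= D by rewrite !addr_ge0.
have c0 k : 0 <= c k by rewrite !mulr_ge0// exprn_ge0.
exists (\sum_(k < p.+1) c k); first by rewrite sumr_ge0.
move=> d k t /andP[d0 d1] kp tB.
apply: (@le_trans _ _ (c k)); last first.
  rewrite (bigD1 (Ordinal (kp : (k < p.+1)%N)))//= lerDl sumr_ge0//.
have pd0 : 0 < p.+1%:R * d by rewrite mulr_gt0.
rewrite /ramp normrM normfV (gtr0_norm pd0) ler_pdivrMl//.
rewrite [leRHS]mulrC /trunc_pow -mulrBr.
rewrite normrM normr_nat /c -!mulrA ler_wpM2l// mulrA.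
have pB b : `|b| <= `|a| + 2 -> `|pospart (t - b)| <= D.
  move=> bB; rewrite /pospart ger0_norm; last by rewrite le_max lexx orbT.
  rewrite ge_max D0 andbT (le_trans (ler_norm _))// (le_trans (ler_normB _ _))//.
  by rewrite /D -addrA lerD// (le_trans tB)// ler_norm.
have b1 : `|a + d| <= `|a| + 2.
  by rewrite (le_trans (ler_normD _ _))// lerD2l gtr0_norm//; lra.
have b2 : `|a + 2 * d| <= `|a| + 2.
  by rewrite (le_trans (ler_normD _ _))// lerD2l gtr0_norm; lra.
apply: le_trans (exp_lipschitz _ (pB _ b1) (pB _ b2)) _.
rewrite -!mulrA ler_wpM2l// ler_wpM2l ?exprn_ge0//.
apply: (@le_trans _ _ d); last by rewrite ler_peMl ?(ltW d0)// ler1n.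
rewrite /pospart.
have [u0|u0] := leP (t - (a + d)) 0; have [w0|w0] := leP (t - (a + 2 * d)) 0;
  rewrite ler_norml; apply/andP; split; lra.
Qed.

End Ramp.

(** * Cutting along a linear functional *)

Section RidgePowers.
Context {R : realType} {G E : normedModType R} {p : nat} {X : set G}.
Variables (oX : open X) (l : {linear G -> R}).
Hypothesis l1 : forall v, `|l v| <= `|v|.

Let l1' v : `|l v| <= 1 * `|v|. Proof. by rewrite mul1r. Qed.

Lemma mul_affine_pow (f : Cp p X E) (a : R) (j : nat) :
  exists g : Cp p X E, forall x : X, g x = (l (val x) - a) ^+ j *: f x.
Proof.
pose q k t : R := if k is k'.+1 then (k' == 0%N)%:R else t - a.
have qd k : (k < p)%N -> forall t : R, is_derive t (1 : R) (q k) (q k.+1 t).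
  move=> _ t; case: k => [|k] /=; last by apply: is_derive_cst.
  by apply: is_derive_eq; rewrite subr0.
have qc k : (k <= p)%N -> continuous (q k).
  move=> _; case: k => [|k] t /=; last by apply: cvg_cst.
  by apply: cvgB; [exact: cvg_id|exact: cvg_cst].
have J := ridge_is_jet l1' qd qc X.
elim: j => [|j [g gE]]; first by exists f => x; rewrite expr0 scale1r.
have [g' [g'E _]] := Cp_mul_jet oX g J.
exists g' => x; rewrite g'E gE /ridge_jet /= big_nil mulr1 scalerA.
by rewrite exprS.
Qed.

Lemma Cp_sumE (I : Type) (r : seq I) (f_ : I -> Cp p X E) (x : X) :
  (\sum_(i <- r) f_ i) x = \sum_(i <- r) f_ i x.
Proof. exact: (big_morph (fun f : Cp p X E => f x)). Qed.

Lemma mul_ramp (f : Cp p X E) (a : R) (K : set X) : compact K ->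
  exists2 M, 0 <= M & forall d, 0 < d <= 1 -> exists g : Cp p X E,
    (forall x : X, g x = ramp p a d 0 (l (val x)) *: f x) /\
    (forall x, K x -> forall j, (j <= p)%N -> `|frechetD g j x| <= M).
Proof.
move=> cK; have [N N0 fN] := Cp_bounded_compact f cK.
have [B KB] : exists B, forall x, K x -> `|l (val x)| <= B.
  have /compact_bounded : compact ((set_val : X -> G) @` K).
    apply: continuous_compact => //; apply: continuous_subspaceT.
    exact: initial_continuous.
  move=> /pinfty_ex_gt0[B _ HB]; exists B => x Kx.
  by apply: le_trans (l1 _) _; apply: HB; exists x.
have [C C0 rC] := ramp_bounded p a B.
exists (2 ^+ p * (C * N)); first by rewrite !mulr_ge0.
move=> d d01.
have J := ridge_is_jet l1' (fun k kp t => is_derive_ramp a d t kp)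
  (fun k _ => @ramp_continuous R p a d k) X.
have [g [gE gN]] := Cp_mul_jet oX f J.
exists g; split=> [x|x Kx j jp].
  by rewrite gE /ridge_jet /= big_nil mulr1.
apply: gN => // [k kp|k kp]; last exact: fN.
apply: (ridge_norm_le l1'); rewrite (max_idPl _)// expr1n mulr1.
by apply: rC => //; exact: KB.
Qed.

End RidgePowers.

Section Cut.
Context {R : realType} {G H E F : normedModType R} {p : nat}.
Variables (X : set G) (Y : set H) (T : {linear Cp p X E -> Cp p Y F}).
Hypotheses (oX : open X) (wT : weakly_compact T) (sT : separating T).
Variables (h : Y -> X) (hP : supports T h).
Variable (l : {linear G -> R}).
Hypothesis l1 : forall v, `|l v| <= `|v|.

Lemma linear_close (x x0 : G) : `|l x - l x0| <= `|x - x0|.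
Proof. by rewrite -linearB. Qed.

(** Weak compactness lets [T] act on the non-smooth function
    [(l - a)_+ ^ p *: f]: seen through functionals [m] on [F], the result is the
    restriction of [T ((l - a) ^ p *: f)] to [l \o h > a], extended by zero, and
    it comes from an element of [Cp p Y F]. *)
Lemma cut_in_Cp (f : Cp p X E) (a : R) : exists u : Cp p Y F,
  forall (m : {linear F -> R}) (y : Y), (forall v, `|m v| <= `|v|) ->
    (l (val (h y)) <= a -> m (u y) = 0) /\
    (a < l (val (h y)) -> forall g : Cp p X E,
      (forall x : X, g x = (l (val x) - a) ^+ p *: f x) -> m (u y) = m (T g y)).
Proof.
have [K cK KP] := weakly_compact_limit wT.
have [M M0 MP] := mul_ramp oX l1 f a cK.
pose d n : R := n.+1%:R^-1.
have d01 n : 0 < d n <= 1.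
  by rewrite invr_gt0 ltr0n /= invf_le1// ler1n.
have d0 n : 0 < d n by have /andP[] := d01 n.
have [f_ f_P] := choice (fun n => MP (d n) (d01 n)).
have [u uP] := KP f_ M (fun n => (f_P n).2).
exists u => m y m1; split=> [ya|ya g gE].
  apply: uP => //.
  have -> : (fun n => m (T (f_ n) y)) = (fun=> 0).
    apply/funext => n; rewrite (supports_local sT hP (d0 n)) ?linear0// => x xd.
    rewrite (f_P n).1 ramp_eq0 ?scale0r//.
    by have := linear_close (val x) (val (h y)); rewrite ler_distl; lra.
  exact: cvg_cst.
have [g_ g_P] := choice (mul_affine_pow oX l1 f a).
pose w i := m (T (g_ (p - i)%N) y).
pose P : {poly R} := \poly_(i < p.+1) (ramp_coef p i * w i).
have dlim : d @ \oo --> (0 : R) by exact: cvg_harmonic.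
apply: uP => //.
have -> : m (T g y) = P.[0].
  rewrite horner_coef0 coef_poly /= ramp_coef0 mul1r /w subn0.
  by congr (m (T _ y)); apply: Cp_eqP => x; rewrite gE g_P.
have : (fun n => P.[d n]) @ \oo --> P.[0].
  by apply: (cvg_comp _ _ dlim); exact: continuous_horner.
have e0 : 0 < (l (val (h y)) - a) / 3 by rewrite divr_gt0// subr_gt0.
apply: cvg_trans; apply: near_eq_cvg.
have /cvgrPdist_lt/(_ _ e0) := dlim.
apply: filterS => n; rewrite sub0r normrN gtr0_norm// => dn.
rewrite /P horner_poly.
have -> : m (T (f_ n) y) = Cp_eval m y
    (T (\sum_(i < p.+1) (ramp_coef p i * d n ^+ i) *: g_ (p - i)%N)).
  apply/eqP; rewrite -subr_eq0 -[m _]/(Cp_eval m y (T (f_ n))) -!linearB /=.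
  rewrite /Cp_eval (supports_local sT hP e0) ?linear0// => x xd.
  rewrite Cp_addE Cp_oppE Cp_sumE (f_P n).1 ramp_poly//; last first.
    by have := linear_close (val x) (val (h y)); rewrite ler_distl; lra.
  rewrite scaler_suml; apply/eqP; rewrite subr_eq0; apply/eqP; apply: eq_bigr => i _.
  by rewrite Cp_scaleE g_P scalerA.
rewrite !linear_sum; apply: eq_bigr => i _; rewrite !linearZ /= /Cp_eval /w.
by rewrite mulrAC.
Qed.

End Cut.

(** * Chains of derivatives on the line *)

Section Calculus.
Context {R : realType}.
Implicit Types (w : nat -> R -> R) (t x r : R).

Definition derivative_chain p (A : set R) w :=
  (forall k, (k < p)%N -> forall t, A t -> is_derive t (1 : R) (w k) (w k.+1 t)) /\
  (forall k, (k <= p)%N -> forall t, A t -> w k x @[x --> t] --> w k t).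

Lemma chain_vanish p A w : open A -> derivative_chain p A w ->
  (forall t, A t -> w 0 t = 0) -> forall k, (k <= p)%N -> forall t, A t -> w k t = 0.
Proof.
move=> oA [wd _] w0; elim=> [//|k IHk] kp t At.
have nA : nbhs t A by apply: open_nbhs_nbhs; split.
have [_ <-] := wd k kp t At.
rewrite (@near_eq_derive _ _ _ _ (cst 0)) ?derive_cst//.
by apply: filterS nA => x Ax; rewrite (IHk (ltnW kp)).
Qed.

Lemma mvt_norm (f df : R -> R) (t x M : R) :
  (forall y, `|y - t| <= `|x - t| -> is_derive y (1 : R) f (df y)) ->
  (forall y, `|y - t| <= `|x - t| -> `|df y| <= M) -> `|f x - f t| <= M * `|x - t|.
Proof.
move=> fd dM.
have fc y : `|y - t| <= `|x - t| -> {for y, continuous f}.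
  move=> yt; have [fy _] := fd y yt.
  by apply: differentiable_continuous; exact/derivable1_diffP.
have [tx|xt] := leP t x.
  have yt y : y \in `[t, x]%R -> `|y - t| <= `|x - t|.
    by rewrite in_itv /= => /andP[ty yx]; rewrite !ger0_norm; lra.
  have [c cx ->] := MVT_segment tx (f := f) (df := df)
    (fun y yi => fd y (yt y (subset_itv_oo_cc yi)))
    (continuous_in_subspaceT (fun y yi => fc y (yt y (set_mem yi)))).
  by rewrite normrM ler_wpM2r// dM// yt.
have yt y : y \in `[x, t]%R -> `|y - t| <= `|x - t|.
  by rewrite in_itv /= => /andP[ty yx]; rewrite !ler0_norm; lra.
have [c cx ftx] := MVT_segment (ltW xt) (f := f) (df := df)
    (fun y yi => fd y (yt y (subset_itv_oo_cc yi)))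
    (continuous_in_subspaceT (fun y yi => fc y (yt y (set_mem yi)))).
by rewrite distrC ftx normrM [`|t - x|]distrC ler_wpM2r// dM// yt.
Qed.

(** By the mean value inequality, downwards from the continuity at order [m]. *)
Lemma chain_little_o p (A : set R) w t m : open A -> derivative_chain p A w ->
  A t -> (m <= p)%N -> (forall k, (k <= m)%N -> w k t = 0) ->
  forall k, (k <= m)%N -> forall e, 0 < e ->
    \forall x \near t, `|w k x| <= e * `|x - t| ^+ (m - k).
Proof.
move=> oA [wd wc] At mp w0 k km e e0.
have [n nE] : exists n, n = (m - k)%N by eexists.
rewrite -nE; elim: n k km nE => [|n IHn] k km nE.
  have -> : k = m by lia.
  have /cvgrPdist_le/(_ _ e0) := wc m mp t At.
  by apply: filterS => x; rewrite w0// sub0r normrN expr0 mulr1.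
have km' : (k.+1 <= m)%N by lia.
have nE' : n = (m - k.+1)%N by lia.
have kp : (k < p)%N by lia.
have nA : nbhs t A by apply: open_nbhs_nbhs; split.
have /nbhs_normP[r /= r0 rP] : \forall x \near t,
    A x /\ `|w k.+1 x| <= e * `|x - t| ^+ n.
  exact: filterI nA (IHn _ km' nE').
apply/nbhs_normP; exists r => //= x xr'.
have xr : `|x - t| < r by rewrite distrC.
have yP y : `|y - t| <= `|x - t| -> A y /\ `|w k.+1 y| <= e * `|y - t| ^+ n.
  by move=> yx; apply: rP; rewrite /= distrC; exact: (le_lt_trans yx xr).
have E : w k x = w k x - w k t by rewrite (w0 k km) subr0.
rewrite E exprSr mulrA.
apply: (mvt_norm (df := w k.+1)) => y yx; first by apply: wd => //; exact: (yP y yx).1.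
apply: le_trans (yP y yx).2 _; rewrite ler_wpM2l ?(ltW e0)//.
by rewrite lerXn2r ?nnegrE.
Qed.

(** All [W (p - i)] vanish to order [p - i] at [t1], by induction on [i]: in the
    relation divided by [s n ^+ i], the terms of index below [i] tend to 0 by
    Taylor expansion at the zeros already found, as [z n - t1] is at most of the
    order of [s n], and those of index above [i] because [s n] does. *)
Lemma vanishing_cascade p (A : set R) (W : nat -> nat -> R -> R) (t1 : R)
    (z s : nat -> R) (C : R) :
  open A -> A t1 -> (forall j, (j <= p)%N -> derivative_chain p A (W j)) ->
  z @ \oo --> t1 -> s @ \oo --> (0 : R) -> (forall n, s n != 0) ->
  (forall n, `|z n - t1| <= C * `|s n|) ->
  (forall n k, (k <= p)%N ->
     \sum_(i < p.+1) 'C(p, i)%:R * s n ^+ i * W (p - i)%N k (z n) = 0) ->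
  W 0 0 t1 = 0.
Proof.
move=> oA At1 Wc zt s0 sn0 zs WE.
suff H i : (i <= p)%N -> forall k, (k <= p - i)%N -> W (p - i)%N k t1 = 0.
  by have := H p (leqnn p) 0%N; rewrite subnn; apply.
have [N] := ubnP i; elim: N i => // N IHN i iN ip k kpi.
have kp : (k <= p)%N by lia.
have Wz j : (j <= p)%N -> W j k (z n) @[n --> \oo] --> W j k t1.
  move=> jp; apply: (cvg_comp _ _ zt); exact: (Wc j jp).2.
have bin_n0 : 'C(p, i)%:R != 0 :> R by rewrite pnatr_eq0 -lt0n bin_gt0.
(* the other terms, divided by s ^ i *)
pose v j n := 'C(p, j)%:R * (s n ^+ j / s n ^+ i) * W (p - j)%N k (z n).
have v0 (j : 'I_p.+1) : j != i :> nat -> v j @ \oo --> (0 : R).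
  rewrite neq_ltn => /orP[ji|ij].
    apply/cvgrPdist_le => e e0.
    pose D := 'C(p, j)%:R * (`|C| ^+ (p - j - k)) + 1 : R.
    have D0 : 0 < D by rewrite ltr_wpDl// mulr_ge0// exprn_ge0.
    have eD : 0 < e / D by rewrite divr_gt0.
    have jp : (j <= p)%N by rewrite -ltnS ltn_ord.
    have Wj0 k' : (k' <= p - j)%N -> W (p - j)%N k' t1 = 0 by apply: IHN; lia.
    have kj : (k <= p - j)%N by lia.
    have H : \forall n \near \oo,
        `|W (p - j)%N k (z n)| <= e / D * `|z n - t1| ^+ (p - j - k).
      have := chain_little_o oA (Wc _ (leq_subr _ _)) At1 (leq_subr j p) Wj0 kj eD.
      by move/zt.
    have s1 : \forall n \near \oo, `|s n| <= 1.
      have /cvgrPdist_le/(_ _ ltr01) := s0.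
      by apply: filterS => n; rewrite sub0r normrN.
    apply: filterS (filterI H s1) => n [Hn sn1]; rewrite sub0r normrN /v.
    have sn : 0 < `|s n| by rewrite normr_gt0.
    rewrite !normrM normr_nat normfV !normrX.
    have Wle : `|W (p - j)%N k (z n)| <= e / D * (`|C| * `|s n|) ^+ (p - j - k).
      apply: le_trans Hn _; rewrite ler_wpM2l ?(ltW eD)// lerXn2r ?nnegrE ?mulr_ge0//.
      by apply: le_trans (zs n) _; rewrite ler_wpM2r// ler_norm.
    apply: le_trans (ler_wpM2l _ Wle) _.
      by rewrite !mulr_ge0// ?invr_ge0 exprn_ge0.
    have -> : 'C(p, j)%:R * (`|s n| ^+ j / `|s n| ^+ i) *
        (e / D * (`|C| * `|s n|) ^+ (p - j - k)) =
      e * ('C(p, j)%:R * `|C| ^+ (p - j - k) / D) * `|s n| ^+ (p - i - k).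
      have E1 : (p - j - k = (p - i - k) + (i - j))%N by lia.
      have E2 : (i = j + (i - j))%N by lia.
      rewrite exprMn [in `|s n| ^+ (p - j - k)]E1 exprD.
      rewrite [in X in _ / X]E2 exprD.
      have nj : `|s n| ^+ j != 0 by rewrite expf_neq0// gt_eqF.
      have nij : `|s n| ^+ (i - j) != 0 by rewrite expf_neq0// gt_eqF.
      have nD : D != 0 by rewrite gt_eqF.
      by field; rewrite nj nij nD.
    rewrite -mulrA ler_piMr ?(ltW e0)//.
    rewrite mulr_ile1 ?mulr_ge0 ?invr_ge0 ?exprn_ge0 ?(ltW D0)//.
      by rewrite ler_pdivrMr// mul1r /D lerDl.
    by rewrite exprn_ile1.
  have vE : v j = (fun n => 'C(p, j)%:R * s n ^+ (j - i) * W (p - j)%N k (z n)).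
    apply/funext => n; rewrite /v; congr (_ * _ * _).
    have E1 : (j = (j - i) + i :> nat)%N by lia.
    by rewrite [in LHS]E1 exprD mulfK// expf_neq0.
  rewrite vE -[X in _ --> X](mul0r (W (p - j)%N k t1)); apply: cvgM; last first.
    by apply: Wz; exact: leq_subr.
  rewrite -[X in _ --> X](mulr0 'C(p, j)%:R); apply: cvgMl_tmp.
  have H := @cvg_comp _ _ _ s (fun x : R => x ^+ (j - i)) _ _ _ s0
    (@exprn_continuous R (j - i) 0).
  have ji0 : (j - i == 0 :> nat)%N = false by lia.
  by rewrite expr0n ji0 in H.
have ip' : (i < p.+1)%N by lia.
pose i0 := Ordinal ip'.
have sumv n : W (p - i)%N k (z n) =
    - ('C(p, i)%:R^-1 * \sum_(j < p.+1 | j != i0) v j n).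
  have := WE n k kp; rewrite (bigD1 i0)//= => /eqP; rewrite addr_eq0 => /eqP E.
  have sni : s n ^+ i != 0 by rewrite expf_neq0.
  have -> : \sum_(j < p.+1 | j != i0) v j n =
      (\sum_(j < p.+1 | j != i0) 'C(p, j)%:R * s n ^+ j * W (p - j)%N k (z n)) /
      s n ^+ i.
    rewrite mulr_suml; apply: eq_bigr => j _; rewrite /v; ring.
  have -> : \sum_(j < p.+1 | j != i0) 'C(p, j)%:R * s n ^+ j * W (p - j)%N k (z n) =
     - ('C(p, i)%:R * s n ^+ i * W (p - i)%N k (z n)) by rewrite E opprK.
  by field; rewrite bin_n0 sni.
have lim0 : W (p - i)%N k (z n) @[n --> \oo] --> (0 : R).
  have -> : (fun n => W (p - i)%N k (z n)) =
    (fun n => - ('C(p, i)%:R^-1 * \sum_(j < p.+1 | j != i0) v j n)).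
    by apply/funext => n; exact: sumv.
  have H := @cvg_big R 'I_p.+1 +%R 0 (fun j => j != i0) (@add_continuous R) nat \oo
    (index_enum 'I_p.+1) v (fun=> 0) _ v0.
  rewrite [X in _ --> X]big1 in H; last by [].
  have H1 := cvgN (cvgMl_tmp (a := 'C(p, i)%:R^-1) (H _)).
  by rewrite mulr0 oppr0 in H1; exact: H1.
exact: (cvg_unique _ (Wz _ (leq_subr _ _)) lim0).
Qed.

End Calculus.

(** * Two-sided crossings *)

Section Crossing.
Context {R : realType}.
Implicit Types (g s : R -> R) (t b z e : R).

Lemma cont_lt g t b : {for t, continuous g} -> g t < b ->
  exists2 e, 0 < e & forall x, `|x - t| < e -> g x < b.
Proof.
move=> gc gt; have e0 : 0 < b - g t by rewrite subr_gt0.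
have /cvgrPdist_lt/(_ _ e0) : g x @[x --> t] --> g t by exact: gc.
move=> /nbhs_normP[e /= e1 eP]; exists e => // x xt.
have : `|g t - g x| < b - g t by apply: eP; rewrite /= distrC.
by rewrite ltr_distlC; lra.
Qed.

Lemma cont_gt g t b : {for t, continuous g} -> b < g t ->
  exists2 e, 0 < e & forall x, `|x - t| < e -> b < g x.
Proof.
move=> gc gt; have e0 : 0 < g t - b by rewrite subr_gt0.
have /cvgrPdist_lt/(_ _ e0) : g x @[x --> t] --> g t by exact: gc.
move=> /nbhs_normP[e /= e1 eP]; exists e => // x xt.
have : `|g t - g x| < g t - b by apply: eP; rewrite /= distrC.
by rewrite ltr_distlC; lra.
Qed.

(** [z] is the supremum of the points where [g] is below [b]. *)
Lemma last_crossing g b : (forall t, 0 <= t <= 1 -> {for t, continuous g}) ->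
  g 0 < b -> b < g 1 -> exists z, [/\ 0 < z < 1, g z = b,
    forall t, z < t -> t <= 1 -> b <= g t &
    forall e, 0 < e -> exists t, [/\ 0 <= t, z - e < t, t < z & g t < b]].
Proof.
move=> gc g0 g1; pose S := [set t | 0 <= t <= 1 /\ g t < b].
have S0 : S 0 by split=> //; rewrite lexx ler01.
have supS : has_sup S.
  by split; [exists 0|exists 1 => t [/andP[]]].
pose z := sup S.
have zub t : S t -> t <= z by exact: sup_upper_bound.
have z0 : 0 <= z by exact: zub.
have z1 : z <= 1 by apply: ge_sup; [exists 0|move=> t [/andP[]]].
have z01 : 0 <= z <= 1 by rewrite z0.
have gz : g z = b.
  apply/eqP; rewrite eq_le; apply/andP; split; rewrite leNgt; apply/negP => H.
  - have [e e0 eP] := cont_gt (gc z z01) H.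
    have [t [t01 tb] zt] := sup_adherent e0 supS.
    have tz : t <= z by apply: zub.
    suff : b < g t by rewrite ltNge (ltW tb).
    by apply: eP; rewrite ltr_distl; rewrite -/z in zt; lra.
  - have [e e0 eP] := cont_lt (gc z z01) H.
    have zlt1 : z < 1.
      by rewrite lt_neqAle z1 andbT; apply/eqP => z1'; move: H; rewrite z1'; lra.
    pose t := z + Num.min (e / 2) (1 - z).
    have m0 : 0 < Num.min (e / 2) (1 - z) by rewrite lt_min subr_gt0 zlt1 divr_gt0.
    have m1 : Num.min (e / 2) (1 - z) <= 1 - z by rewrite ge_min lexx orbT.
    have m2 : Num.min (e / 2) (1 - z) <= e / 2 by rewrite ge_min lexx.
    suff : t <= z by rewrite /t; lra.
    apply: zub; split; first by rewrite /t; lra.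
    by apply: eP; rewrite /t addrAC subrr add0r gtr0_norm//; lra.
have zn0 : z != 0 by apply/eqP => z0'; move: gz; rewrite z0'; lra.
have zn1 : z != 1 by apply/eqP => z1'; move: gz; rewrite z1'; lra.
exists z; split=> //.
- by rewrite !lt_neqAle z0 z1 zn1 eq_sym zn0.
- move=> t zt t1; rewrite leNgt; apply/negP => tb.
  have : t <= z by apply: zub; split=> //; rewrite t1 andbT (le_trans z0)// ltW.
  by rewrite leNgt zt.
- move=> e e0; have [t [/andP[t0 t1] tb] zt] := sup_adherent e0 supS.
  exists t; split=> //; rewrite lt_neqAle zub ?andbT//.
    by apply/eqP => tz; move: tb; rewrite tz gz ltxx.
  by split=> //; rewrite t0.
Qed.

(** Take for [z n] crossings of increasing levels of the tilted function
    [g t := s t - c * t]. The tilt makes [s] larger than [s (z n)] on all of the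
    right of [z n], where [g] may only touch its level, and forces a slope of at
    least [c] between any two of these points. *)
Lemma crossing_sequence s : (forall t, 0 <= t <= 1 -> {for t, continuous s}) ->
  s 0 < s 1 -> exists (c t1 : R) (z : nat -> R), [/\ 0 < c, 0 <= t1 <= 1,
    z @ \oo --> t1,
    forall n, [/\ 0 < z n < 1, z n < t1 & c * (t1 - z n) <= s t1 - s (z n)] &
    forall n e, 0 < e ->
      (exists t, [/\ 0 <= t <= 1, `|t - z n| < e & s t < s (z n)]) /\
      (exists t, [/\ 0 <= t <= 1, `|t - z n| < e & s (z n) < s t])].
Proof.
move=> sc s01; pose c := (s 1 - s 0) / 2.
have c0 : 0 < c by rewrite divr_gt0// subr_gt0.
pose g t := s t - c * t.
have gc t : 0 <= t <= 1 -> {for t, continuous g}.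
  move=> t01; apply: cvgB; first exact: sc.
  by apply: cvgMl_tmp; exact: cvg_id.
have g0E : g 0 = s 0 by rewrite /g mulr0 subr0.
have g1E : g 1 = s 0 + c by rewrite /g /c; lra.
pose b n := s 0 + c - c / n.+2%:R.
have bn n : g 0 < b n /\ b n < g 1.
  rewrite g0E g1E /b; have n0 : 0 < c / n.+2%:R by rewrite divr_gt0.
  split; last by rewrite ltrBlDr ltrDl.
  rewrite -addrA ltrDl subr_gt0.
  by rewrite ltr_pdivrMr// ltr_pMr// ltr1n.
have [z zP] := choice (fun n => last_crossing gc (bn n).1 (bn n).2).
have bmono n m : (n < m)%N -> b n < b m.
  move=> nm; rewrite /b ltrD2l ltrN2 ltr_pM2l// ltf_pV2 ?posrE//.
  by rewrite ltr_nat !ltnS.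
have zmono n m : (n < m)%N -> z n < z m.
  move=> nm; have [/andP[_ zn1] gzn _ _] := zP n; have [_ gzm zm _] := zP m.
  have := bmono _ _ nm; rewrite ltNge => /negP bnm.
  rewrite ltNge le_eqVlt; apply/negP => /predU1P[E|mn].
    by apply: bnm; rewrite -gzn -gzm E.
  by apply: bnm; rewrite -gzn; apply: zm => //; exact: ltW.
have sE n : s (z n) = b n + c * z n.
  by have [_ gz _ _] := zP n; rewrite -gz /g; ring.
have zub : has_ubound (range z).
  by exists 1 => _ [n _ <-]; have [/andP[_ /ltW]] := zP n.
have znd : nondecreasing_seq z.
  by apply/nondecreasing_seqP => n; apply: ltW; exact: zmono.
have zlim := nondecreasing_cvgn znd zub.
set t1 := sup (range z) in zlim.
have zt1 n : z n < t1.
  apply: (lt_le_trans (zmono n n.+1 (ltnSn n))).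
  apply: sup_upper_bound; first by split=> //; exists (z 0%N), 0%N.
  by exists n.+1.
have t101 : 0 <= t1 <= 1.
  have [/andP[z0 _] _ _ _] := zP 0%N.
  rewrite (ltW (lt_trans z0 (zt1 0%N))) /=.
  apply: ge_sup; first by exists (z 0%N), 0%N.
  by move=> _ [n _ <-]; have [/andP[_ /ltW]] := zP n.
have slim : s (z n) @[n --> \oo] --> s t1.
  by apply: (cvg_comp _ _ zlim); exact: sc.
exists c, t1, z; split=> //.
- move=> n; split=> //; first by have [] := zP n.
  have L1 : c * (z m - z n) @[m --> \oo] --> c * (t1 - z n).
    by apply: cvgMl_tmp; apply: cvgB => //; exact: cvg_cst.
  have L2 : s (z m) - s (z n) @[m --> \oo] --> s t1 - s (z n).
    by apply: cvgB => //; exact: cvg_cst.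
  apply: (ler_cvg_to L1 L2); exists n.+1 => // m /= nm.
  by rewrite !sE; have := bmono _ _ nm; lra.
- move=> n e e0; have [/andP[z0 z1] gz zr zl] := zP n; split.
    have [t [t0 zt tz gt]] := zl e e0; exists t; split.
    + by rewrite t0 (ltW (lt_trans tz z1)).
    + by rewrite ltr_distl; lra.
    + have ct : c * t < c * z n by rewrite ltr_pM2l.
      by move: gt; rewrite -gz /g; lra.
  pose t := z n + Num.min (e / 2) (1 - z n).
  have m0 : 0 < Num.min (e / 2) (1 - z n) by rewrite lt_min subr_gt0 z1 divr_gt0.
  have m1 : Num.min (e / 2) (1 - z n) <= 1 - z n by rewrite ge_min lexx orbT.
  have m2 : Num.min (e / 2) (1 - z n) <= e / 2 by rewrite ge_min lexx.
  have tz : z n < t by rewrite /t; lra.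
  have t1' : t <= 1 by rewrite /t; lra.
  exists t; split; first by rewrite t1' (ltW (lt_trans z0 tz)).
    by rewrite /t addrAC subrr add0r gtr0_norm//; lra.
  have ct : c * z n < c * t by rewrite ltr_pM2l.
  by have := zr t tz t1'; rewrite -gz /g; lra.
Qed.

End Crossing.

(** * Local constancy *)

Section LineChain.
Context {R : realType} {H F : normedModType R} {p : nat} {Y : set H}.
Variables (oY : open Y) (m : {linear F -> R}) (y0 v : H).
Hypothesis m1 : forall x, `|m x| <= `|x|.

Definition line_point (t : R) : H := y0 + t *: v.

Definition line_deriv (g : Cp p Y F) (k : nat) (t : R) : R :=
  m (jet_of g (line_point t) (nseq k v)).

Definition line_domain : set R := [set t | Y (line_point t)].

Lemma line_point_continuous : continuous line_point.
Proof.
by move=> t; apply: cvgD; [exact: cvg_cst|apply: cvgZr_tmp; exact: cvg_id].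
Qed.

Lemma line_domainP t : line_domain t -> exists y : Y, val y = line_point t.
Proof. exact: (@valP_ex _ _ Y). Qed.

Lemma line_domain_open : open line_domain.
Proof. by apply: open_comp oY => t _; exact: line_point_continuous. Qed.

Lemma nprod_nseq k : nprod (nseq k v) = `|v| ^+ k.
Proof.
elim: k => [|k IHk]; first by rewrite /nprod big_nil.
by rewrite nprod_cons IHk exprS.
Qed.

(** Each derivation along the line prepends the direction [v] to the arguments
    of the jet. *)
Lemma line_deriv_chain (g : Cp p Y F) : derivative_chain p line_domain (line_deriv g).
Proof.
have gJ := Cp_jet oY g.
have dist t x : line_point x - line_point t = (x - t) *: v.
  by rewrite /line_point scalerBl opprD addrACA subrr add0r.
split=> [k kp t Yt|k kp t Yt].
  apply: is_derive_near => e e0.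
  pose d := `|v| ^+ k.+1 + 1.
  have d0 : 0 < d by rewrite ltr_wpDl// exprn_ge0.
  have ed : 0 < e / d by rewrite divr_gt0.
  apply: filterS (near_comp line_point_continuous (jet_diff gJ kp Yt ed)) => x.
  move=> /(_ (nseq k v) (size_nseq k v)).
  rewrite dist (multilin_headZ _ _ _ (jet_multilin gJ _)) nprod_nseq => Hx.
  rewrite /line_deriv mulrC -[(x - t) * _]/((x - t) *: _) -linearZ /= -!linearB.
  apply: le_trans (m1 _) _; apply: le_trans Hx _.
  rewrite normrZ.
  have -> : e / d * (`|x - t| * `|v|) * `|v| ^+ k = e * (`|v| ^+ k.+1 / d) * `|x - t|.
    by rewrite exprS; ring.
  by rewrite ler_wpM2r// ler_piMr ?(ltW e0)// ler_pdivrMr// mul1r /d lerDl.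
apply/cvgrPdist_le => e e0.
pose d := `|v| ^+ k + 1.
have d0 : 0 < d by rewrite ltr_wpDl// exprn_ge0.
have ed : 0 < e / d by rewrite divr_gt0.
apply: filterS (near_comp line_point_continuous (jet_cont gJ kp Yt ed)) => x.
move=> /(_ (nseq k v) (size_nseq k v)); rewrite nprod_nseq => Hx.
rewrite /line_deriv distrC -linearB; apply: le_trans (m1 _) _.
apply: le_trans Hx _.
by rewrite mulrAC ler_pdivrMr// ler_wpM2l ?(ltW e0)// lerDl.
Qed.

Lemma line_deriv_lin (c : R) (f g : Cp p Y F) k t : (k <= p)%N -> line_domain t ->
  line_deriv (c *: f + g) k t = c * line_deriv f k t + line_deriv g k t.
Proof.
move=> kp /line_domainP[y yt]; rewrite /line_deriv -yt.
have kE : size (nseq k v) = k by rewrite size_nseq.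
rewrite !(jet_of_size _ _ kE) Cp_frechetD_lin//.
rewrite -[X in m X]/(c *: frechetD f k y _ + frechetD g k y _).
by rewrite linearD linearZ.
Qed.

Lemma line_deriv0 k t : (k <= p)%N -> line_domain t -> line_deriv 0 k t = 0.
Proof.
move=> kp Yt; have := line_deriv_lin 1 0 0 kp Yt.
by rewrite scaler0 addr0 mul1r => /eqP; rewrite -subr_eq subrr eq_sym => /eqP.
Qed.

Lemma line_deriv_sum (I : Type) (r : seq I) (c : I -> R) (g_ : I -> Cp p Y F) k t :
  (k <= p)%N -> line_domain t ->
  line_deriv (\sum_(i <- r) c i *: g_ i) k t =
    \sum_(i <- r) c i * line_deriv (g_ i) k t.
Proof.
move=> kp Yt; elim: r => [|i r IHr]; first by rewrite !big_nil line_deriv0.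
by rewrite !big_cons line_deriv_lin// IHr.
Qed.

Lemma line_deriv_val (g : Cp p Y F) t (y : Y) : val y = line_point t ->
  line_deriv g 0 t = m (g y).
Proof. by move=> yt; rewrite /line_deriv -yt jet_of_nil. Qed.

End LineChain.

Lemma cont_zero {R : realType} (w : R -> R) (z : R) : w t @[t --> z] --> w z ->
  (forall e, 0 < e -> exists2 t, `|t - z| < e & w t = 0) -> w z = 0.
Proof.
move=> wc H; apply/eqP; apply: contrapT => /negP wz.
have e0 : 0 < `|w z| by rewrite normr_gt0.
have /cvgrPdist_lt/(_ _ e0)/nbhs_normP[e /= e1 eP] := wc.
have [t tz wt] := H e e1.
have := eP t; rewrite /= distrC wt subr0 ltxx; by move/(_ tz).
Qed.

Section LocallyConstant.
Context {R : realType} {G H E F : normedModType R} {p : nat}.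
Variables (X : set G) (Y : set H) (T : {linear Cp p X E -> Cp p Y F}).
Hypotheses (oX : open X) (oY : open Y).
Hypotheses (wT : weakly_compact T) (sT : separating T) (nT : nowhere_trivial T).
Variables (h : Y -> X) (hP : supports T h).

(** The heart of the matter: on a segment where [l \o h] is not constant, the
    functions [T ((l - a) ^+ p *: f)] would vanish to order [p] at too many
    points for [T f] not to vanish at any of them. *)
Lemma support_locally_constant (y0 : Y) : exists2 r : R, 0 < r &
  forall y : Y, `|val y - val y0| < r -> h y = h y0.
Proof.
have [f Tf] := nT y0.
have [m [mf m1]] := hahn_banach_norming (T f y0).
have mf0 : 0 < `|T f y0| by rewrite normr_gt0.
have e0 : 0 < `|T f y0| / 2 by rewrite divr_gt0.
have [d d0 dP] := Cp_near oY (T f) y0 e0.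
have mTf (y : Y) : `|val y - val y0| < d -> m (T f y) != 0.
  move=> /dP yd; apply/eqP => my.
  have := m1 (T f y - T f y0); rewrite linearB my mf sub0r normrN normr_id /= => H1.
  by have := le_trans H1 yd; lra.
have : nbhs (val y0) Y by apply: open_nbhs_nbhs; split=> //; exact: set_valP.
move=> /nbhs_normP[r0 /= r00 r0Y].
exists (Num.min d r0); first by rewrite lt_min d0.
move=> y1; rewrite lt_min => /andP[y1d y1r].
apply: contrapT => hy.
pose v := val y1 - val y0.
have hv : val (h y1) - val (h y0) != 0.
  by rewrite subr_eq0; apply/eqP => E1; apply: hy; exact: val_inj.
have [l [lh l1]] := hahn_banach_norming (val (h y1) - val (h y0)).
pose pt := line_point (val y0) v.
pose A := line_domain (Y := Y) (val y0) v.
have oA : open A by exact: (@line_domain_open R H Y oY (val y0) v).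
have ptA t : 0 <= t <= 1 -> A t /\ `|pt t - val y0| < d.
  move=> /andP[t0 t1].
  have : `|pt t - val y0| <= `|v|.
    by rewrite /pt /line_point addrAC subrr add0r normrZ ger0_norm// ler_piMl.
  move=> tv; split; last exact: le_lt_trans y1d.
  by apply: r0Y; rewrite /= distrC; exact: le_lt_trans y1r.
pose s t : R := l ('valL_0 (fun y : Y => val (h y)) (pt t)).
have sE t (y : Y) : val y = pt t -> s t = l (val (h y)).
  by move=> yt; rewrite /s -yt valLE.
have scont t : A t -> {for t, continuous s}.
  move=> At; have [y yt] := line_domainP At.
  apply/cvgrPdist_lt => e e1.
  have [r r1 rP] := supports_continuous oY sT hP y e1.
  have nt : nbhs (pt t) (ball (pt t) r) by exact: nbhsx_ballx.
  have nA : nbhs t A by apply: open_nbhs_nbhs.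
  apply: filterS (filterI nA (line_point_continuous (x := t) nt)) => x [Ax].
  rewrite /preimage /= -ball_normE /= => xt.
  have [z zx] := line_domainP Ax.
  rewrite (sE t y yt) (sE x z zx) -linearB (le_lt_trans (l1 _))// distrC.
  by apply: rP; rewrite zx yt distrC.
have [c [t1 [z [c0 t101 zlim zP zcross]]]] : exists (c t1 : R) (z : nat -> R),
    [/\ 0 < c, 0 <= t1 <= 1, z @ \oo --> t1,
    forall n, [/\ 0 < z n < 1, z n < t1 & c * (t1 - z n) <= s t1 - s (z n)] &
    forall n e, 0 < e ->
      (exists t, [/\ 0 <= t <= 1, `|t - z n| < e & s t < s (z n)]) /\
      (exists t, [/\ 0 <= t <= 1, `|t - z n| < e & s (z n) < s t])].
  apply: crossing_sequence => [t t01|]; first exact/scont/(ptA t t01).1.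
  rewrite (sE 0 y0); last by rewrite /pt /line_point scale0r addr0.
  rewrite (sE 1 y1); last by rewrite /pt /line_point scale1r subrKC.
  by rewrite -subr_gt0 -linearB lh normr_gt0.
have [At1 pt1] := ptA t1 t101.
have [g_ g_P] := choice (mul_affine_pow oX l1 f (s t1)).
pose W j := line_deriv m (val y0) v (T (g_ j)).
have zn01 n : 0 <= z n <= 1.
  by have [/andP[z0 z1] _ _] := zP n; rewrite !ltW.
have Az n : A (z n) by have [] := ptA (z n) (zn01 n).
(* T gb and its cut at the level s (z n) agree where s > s (z n), the cut is 0
   where s < s (z n), and both sets accumulate at z n *)
have vanish n (gb : Cp p X E) :
    (forall x : X, gb x = (l (val x) - s (z n)) ^+ p *: f x) ->
    forall k, (k <= p)%N -> line_deriv m (val y0) v (T gb) k (z n) = 0.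
  move=> gbE k kp.
  have [u uP] := cut_in_Cp oX wT sT hP l1 f (s (z n)).
  pose D := T gb - u.
  have oO (P : set R) : (forall t, A t -> P t -> \forall x \near t, P x) ->
      open (A `&` P).
    move=> PP; rewrite openE => t [At Pt]; apply: filterI; last exact: PP.
    by apply: open_nbhs_nbhs.
  have oL : open (A `&` [set t | s t < s (z n)]).
    apply: oO => t At st; have [e e1 eP] := cont_lt (scont t At) st.
    by apply/nbhs_normP; exists e => // x /=; rewrite distrC => /eP.
  have oU : open (A `&` [set t | s (z n) < s t]).
    apply: oO => t At st; have [e e1 eP] := cont_gt (scont t At) st.
    by apply/nbhs_normP; exists e => // x /=; rewrite distrC => /eP.
  have sub (B : set R) (g : Cp p Y F) :
      derivative_chain p (A `&` B) (line_deriv m (val y0) v g).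
    have [gd gc] := line_deriv_chain oY (val y0) v m1 g.
    by split=> [j jp t [At _]|j jp t [At _]]; [exact: gd|exact: gc].
  have cz (g : Cp p Y F) : line_deriv m (val y0) v g k t @[t --> z n] -->
      line_deriv m (val y0) v g k (z n).
    exact: ((line_deriv_chain oY (val y0) v m1 g).2 k kp _ (Az n)).
  have uz : line_deriv m (val y0) v u k (z n) = 0.
    apply: (cont_zero (cz u)) => e e1.
    have [[t [t01 tz st]] _] := zcross n e e1; exists t => //.
    apply: (chain_vanish oL (sub _ u)) => //; last by split=> //; exact: (ptA t t01).1.
    move=> x [/line_domainP[y yx] sx].
    by rewrite (line_deriv_val _ _ yx) (uP m y m1).1// -(sE x)// ltW.
  have Dz : line_deriv m (val y0) v D k (z n) = 0.
    apply: (cont_zero (cz D)) => e e1.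
    have [_ [t [t01 tz st]]] := zcross n e e1; exists t => //.
    apply: (chain_vanish oU (sub _ D)) => //; last by split=> //; exact: (ptA t t01).1.
    move=> x [/line_domainP[y yx] sx].
    rewrite (line_deriv_val _ _ yx) Cp_addE Cp_oppE linearB /=.
    by rewrite ((uP m y m1).2 _ gb gbE) ?subrr// -(sE x).
  have -> : T gb = 1 *: D + u by rewrite scale1r subrK.
  by rewrite (line_deriv_lin _ _ _ _ kp (Az n)) Dz uz mulr0 addr0.
have st1 n : 0 < s t1 - s (z n).
  have [_ zt le] := zP n; apply: lt_le_trans le.
  by rewrite mulr_gt0// subr_gt0.
suff : W 0%N 0%N t1 = 0.
  have [y yt] := line_domainP At1.
  rewrite /W (line_deriv_val _ _ yt); apply/eqP.
  have -> : g_ 0%N = f by apply: Cp_eqP => x; rewrite g_P expr0 scale1r.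
  by apply: mTf; rewrite yt.
apply: (@vanishing_cascade R p A W t1 z (fun n => s t1 - s (z n)) c^-1) => //.
- by move=> j _; exact: line_deriv_chain.
- have slim : s (z n) @[n --> \oo] --> s t1.
    by apply: (cvg_comp _ _ zlim); exact: scont.
  rewrite -(subrr (s t1)); apply: cvgB => //; exact: cvg_cst.
- by move=> n; rewrite gt_eqF.
- move=> n; have [_ zt le] := zP n.
  rewrite (gtr0_norm (st1 n)) distrC gtr0_norm ?subr_gt0//.
  by rewrite ler_pdivlMl.
- move=> n k kp.
  (* (l - s (z n)) ^+ p expanded in powers of l - s t1 *)
  pose gb := \sum_(i < p.+1) ('C(p, i)%:R * (s t1 - s (z n)) ^+ i) *: g_ (p - i)%N.
  have gbE x : gb x = (l (val x) - s (z n)) ^+ p *: f x.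
    rewrite /gb Cp_sumE.
    have -> : l (val x) - s (z n) = (l (val x) - s t1) + (s t1 - s (z n)).
      by rewrite addrA subrK.
    rewrite exprDn scaler_suml; apply: eq_bigr => i _.
    by rewrite Cp_scaleE g_P scalerA -mulr_natl; congr (_ *: _); ring.
  have := vanish n gb gbE k kp.
  rewrite /gb linear_sum.
  under eq_bigr do rewrite linearZ.
  by rewrite (line_deriv_sum _ _ _ _ kp (Az n)).
Qed.

End LocallyConstant.

Theorem theorem23 (R : realType) (G H E F : completeNormedModType R)
  (X : set G) (Y : set H) (p : nat) (T : {linear Cp p X E -> Cp p Y F}) :
  open X -> open Y -> has_bump p G -> (1 <= p)%N ->
  weakly_compact T -> separating T -> nowhere_trivial T ->
  exists2 h : Y -> X, is_support_map T h &
    exists P : set (set Y),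
      [/\ partition P id [set: Y],
          forall B, P B -> clopen B &
          forall B, P B -> exists x, forall y, B y -> h y = x].
Proof.
move=> oX oY bump _ wT sT nT.
have [h hP] := exists_supports oX bump wT nT.
exists h; first exact: supports_is_support_map.
have hloc (y0 : Y) : \forall y \near y0, h y = h y0.
  have [r r0 hr] := support_locally_constant oX oY wT sT nT hP y0.
  have : \forall y \near val y0, `|y - val y0| < r.
    by apply/nbhs_normP; exists r => //= y /=; rewrite distrC.
  move/(near_val oY y0 (fun y => `|y - val y0| < r)).
  by apply: (@filterS _ _ (nbhs_filter y0)) => y; exact: hr.
pose fiber x : set Y := [set y | h y = x].
have ofiber (Q : set X) : open [set y : Y | Q (h y)].
  rewrite openE => y Qy; have := hloc y.
  by apply: (@filterS _ _ (nbhs_filter y)) => z /= ->.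
exists [set B | exists y, B = fiber (h y)]; split.
- split=> [|A B [y ->] [z ->] [t [/= ty tz]]|_ [y ->]]; last by exists y.
    by apply/seteqP; split=> // y _; exists (fiber (h y)) => //; exists y.
  by congr fiber; rewrite -ty tz.
- move=> _ [y ->]; split; first exact: (ofiber (fun x => x = h y)).
  by rewrite -openC; exact: (ofiber (fun x => x <> h y)).
- by move=> _ [y ->]; exists (h y).
Qed.
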